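(* Let $\omega$ be a nondegenerate antisymmetric bilinear form on $\mathbb{R}^n$ and let $\Omega^{\alpha,\beta}$ ($\alpha,\beta\in\mathbb{Z}\times\{1,\dots,n\}$) be the entries of the inverse of the matrix of the antisymmetric form $\Omega(\gamma^1,\gamma^2)=\int_0^1\omega(\gamma^1(s),\gamma^2(s))\,ds$ in the Fourier basis $(\gamma_{k,i})$. For finite sums $F_1=\sum b^1_IF^I$, $F_2=\sum b^2_IF^I$ put $$F_1*_hF_2=\sum_{l\ge 0}\frac{h^l}{l!}\sum_{\alpha_1,\beta_1,\dots,\alpha_l,\beta_l}\Omega^{\alpha_1,\beta_1}\cdots\Omega^{\alpha_l,\beta_l}\; \colon\! \big(a_{\alpha_1}\cdots a_{\alpha_l}F_1\big)\big(a_{\beta_1}\cdots a_{\beta_l}F_2\big)\colon .$$ Then $*_h$ extends to a star-product on $W\cdot N_{\infty-}[[h]]$ (with respect to the Poisson structure $\{\cdot,\cdot\}$ on $W\cdot N_{\infty-}$ obtained by extending $\{F_1,F_2\}=\sum_{\alpha,\beta}\Omega^{\alpha,\beta}\colon (a_\alpha F_1)(a_\beta F_2)\colon$ continuously from finite sums).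
   Context: Basis. $H(S^1;\mathbb{R}^n)$ is the Hilbert space of maps $\gamma:S^1=\mathbb{R}/\mathbb{Z}\to\mathbb{R}^n$ with $\|\gamma\|^2=\int_0^1|\gamma(s)|^2ds+\int_0^1|\gamma'(s)|^2ds<\infty$. Let $C_1=4\pi^2$ and let $e_1,\dots,e_n$ be the canonical basis of $\mathbb{R}^n$. The Fourier orthonormal basis is $\gamma_{0,i}=e_i$, $\gamma_{k,i}(s)=\sqrt2\,(C_1k^2+1)^{-1/2}e_i\cos(2\pi ks)$ for $k>0$, $\gamma_{k,i}(s)=\sqrt2\,(C_1k^2+1)^{-1/2}e_i\sin(2\pi ks)$ for $k<0$ ($k\in\mathbb{Z}$, $1\le i\le n$). In this basis the matrix of $\Omega$ is $\Omega_{(k,i),(k',j)}=\delta_{k,k'}(C_1k^2+1)^{-1}\omega_{i,j}$ with $\omega_{i,j}=\omega(e_i,e_j)$; its inverse is $\Omega^{(k,i),(k',j)}=\delta_{k,k'}(C_1k^2+1)\,\omega^{i,j}$, where $(\omega^{i,j})$ is the inverse matrix of $(\omega_{i,j})$. Hida space. A multiindex $I$ is a finite multiset (possibly empty) $\{(k_1,i_1),\dots,(k_{|I|},i_{|I|})\}$ of elements of $\mathbb{Z}\times\{1,\dots,n\}$, of cardinality $|I|$. Its Hida weight is $w_r(I)=\prod_{j=1}^{|I|}\big(\sqrt{C_1k_j^2+1}\big)^r$. $F^I$ denotes the normalized symmetric tensor product of the $\gamma_{k_j,i_j}$, $(k_j,i_j)\in I$, in the symmetric Fock space ($F^\emptyset=1$).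 For $r,C>0$, $W\cdot N_{r,C}$ is the Hilbert space of series $F=\sum_I b_IF^I$, $b_I\in\mathbb{C}$, with $\|F\|_{r,C}^2=\sum_I|b_I|^2w_r(I)C^{|I|}<\infty$. The Hida test function space is $W\cdot N_{\infty-}=\bigcap_{r>0,C>0}W\cdot N_{r,C}$ with the Fréchet topology of all these norms. A finite sum is an $F$ with finitely many nonzero $b_I$. Wick product. $\colon F^{I_1}F^{I_2}\colon=F^{I_1\cup I_2}$, where $I_1\cup I_2$ is the concatenation (multiset union), extended bilinearly to series: the coefficient of $F^I$ in $\colon F_1F_2\colon$ is $\sum_{I_1\cup I_2=I}b^1_{I_1}b^2_{I_2}$. Annihilation operators. $a_\alpha$, $\alpha\in\mathbb{Z}\times\{1,\dots,n\}$, is the linear operator with $a_\alpha F^I=m\,F^{I\setminus\{\alpha\}}$, where $m$ is the multiplicity of $\alpha$ in $I$ and $I\setminus\{\alpha\}$ is $I$ with one copy of $\alpha$ removed; $a_\alpha F^I=0$ if $m=0$. Star-product. Given a Poisson structure $\{\cdot,\cdot\}$ on $W\cdot N_{\infty-}$, a star-product on $W\cdot N_{\infty-}[[h]]$ (formal power series in $h$ with coefficients in $W\cdot N_{\infty-}$) is a $\mathbb{C}[[h]]$-bilinear product $*_h$ on $W\cdot N_{\infty-}[[h]]$, given for $F_1,F_2\in W\cdot N_{\infty-}$ by $F_1*_hF_2=\sum_{l\ge0}h^lP_l(F_1,F_2)$ with $P_l(F_1,F_2)\in W\cdot N_{\infty-}$ and extended by $\mathbb{C}[[h]]$-bilinearity,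 such that for all $F_1,F_2,F_3\in W\cdot N_{\infty-}$: (i) $P_0(F_1,F_2)=\colon F_1F_2\colon$; (ii) $P_1(F_1,F_2)-P_1(F_2,F_1)=2\{F_1,F_2\}$; (iii) for all $r,C>0$ and $l\ge 0$ there exist $r_1,C_1'>0$ and $K$ such that $\|P_l(F_1,F_2)\|_{r,C}\le K\|F_1\|_{r_1,C_1'}\|F_2\|_{r_1,C_1'}$ for all $F_1,F_2$, and for $l\ge1$ $P_l$ vanishes when one of its arguments is constant; (iv) $F_1*_h(F_2*_hF_3)=(F_1*_hF_2)*_hF_3$. A Poisson structure on $W\cdot N_{\infty-}$ is a $\mathbb{C}$-bilinear map $\{\cdot,\cdot\}:W\cdot N_{\infty-}\times W\cdot N_{\infty-}\to W\cdot N_{\infty-}$ that is antisymmetric, satisfies the Jacobi identity, is a derivation for the Wick product in each argument, satisfies $\{1,F\}=0$, and is such that for all $r,C>0$ there exist $r_1,C_1'>0$ and $K$ with $\|\{F_1,F_2\}\|_{r,C}\le K\|F_1\|_{r_1,C_1'}\|F_2\|_{r_1,C_1'}$. *)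

(* Defs.v *)
From HB Require Import structures.
From mathcomp Require Import all_boot all_order all_algebra.
From mathcomp Require Import finmap multiset complex.
From mathcomp Require Import all_classical all_reals all_analysis.
From mathcomp Require Import zify ring lra.

Set Implicit Arguments.
Unset Strict Implicit.
Unset Printing Implicit Defensive.

Import Order.TTheory GRing.Theory Num.Theory numFieldNormedType.Exports Normc.
Local Open Scope classical_set_scope.
Local Open Scope mset_scope.
Local Open Scope complex_scope.
Local Open Scope ring_scope.

Definition mode (n : nat) : choiceType := (int * 'I_n)%type.

Section Fourier.
Variables (R : realType) (n : nat).

(* The eigenvalue [C_1 k^2 + 1], with [C_1 = 4 pi^2]. *)
Definition symb (k : int) : R := 4 * pi ^+ 2 * k%:~R ^+ 2 + 1.

(* Maps on the circle R/Z are represented as functions on R; only their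
   restriction to [0, 1] is used. *)
Definition fourier (a : mode n) (s : R) : 'rV[R]_n :=
  if a.1 == 0 then 'e_(a.2)
  else (Num.sqrt 2 / Num.sqrt (symb a.1) *
        (if 0 < a.1 then cos (2 * pi * a.1%:~R * s)
         else sin (2 * pi * a.1%:~R * s))) *: 'e_(a.2).

Variable om : 'rV[R]_n -> 'rV[R]_n -> R.

Definition Omega (g1 g2 : R -> 'rV[R]_n) : R :=
  \int[lebesgue_measure]_(s in `[0, 1]) om (g1 s) (g2 s).

Definition Omega_matrix (a b : mode n) : R := Omega (fourier a) (fourier b).

(* [\sum_(b \in setT)] is the sum over a finite support.  The rows and columns
   of [A := Omega_matrix] are finitely supported, so the sums below are then
   genuine and the two-sided inverse is unique. *)
Definition inverse_matrix (A B : mode n -> mode n -> R) : Prop :=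
  forall a c,
    \sum_(b \in [set: mode n]) A a b * B b c = (a == c)%:R /\
    \sum_(b \in [set: mode n]) B a b * A b c = (a == c)%:R.

End Fourier.

Section FockSeries.
Variables (R : realType) (n : nat).

(* The formal series [\sum_I b_I F^I] is the family of its coefficients. *)
Definition fseries := {mset mode n} -> R[i].
HB.instance Definition _ := GRing.Lmodule.on fseries.
Implicit Types (F G : fseries) (I J : {mset mode n}) (a : mode n) (r c : R).

Definition fbasis I : fseries := fun J => (J == I)%:R.

Definition finite_sum F : Prop := finite_set [set I | F I != 0].

(* The product over [a <- I] counts multiplicities. *)
Definition weight r I : R := \prod_(a <- I) (Num.sqrt (symb R a.1)) `^ r.

Definition hterm r c F I : R := normc (F I) ^+ 2 * weight r I * c ^+ size I.

Definition hnorm2 r c F : \bar R :=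
  (\esum_(I in [set: {mset mode n}]) (hterm r c F I)%:E)%E.

Definition wick F G : fseries := fun I =>
  \sum_(p \in [set p : {mset mode n} * {mset mode n} | p.1 `+` p.2 = I])
    F p.1 * G p.2.

(* The operator [a_alpha] on coefficients: [F^J] only arises from
   [F^(alpha + J)], in which [alpha] has multiplicity [J alpha + 1]; see
   [annih_basis]. *)
Definition annih a F : fseries := fun J => (J a).+1%:R * F (a +` J).

Lemma annih_basis a I : annih a (fbasis I) = (I a)%:R *: fbasis (I `\ a).
Proof.
apply/funext => J; rewrite /annih /fbasis.
change ((J a).+1%:R * (a +` J == I)%:R = (I a)%:R * (J == I `\ a)%:R :> R[i]).
have [<-|ne] := eqVneq (a +` J) I.
  suff -> : (a +` J) `\ a = J by rewrite eqxx mset1DE eqxx.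
  by apply/msetP => b; rewrite msetB1E mset1DE addKn.
rewrite mulr0; have [eJ|_] := eqVneq J (I `\ a); last by rewrite mulr0.
rewrite mulr1; case Ia : (I a) => [//|m]; exfalso; move/eqP: ne; apply.
apply/msetP => b; rewrite eJ mset1DE msetB1E.
by case: eqVneq => [->|_]; rewrite ?Ia ?add0n ?subn0 // add1n subn1.
Qed.

(* Finite sums [F] and [G] make the family over [setT] finitely supported. *)
Definition poisson_formula (W : mode n -> mode n -> R) F G : fseries :=
  \sum_(q \in [set: mode n * mode n])
    (W q.1 q.2)%:C *: wick (annih q.1 F) (annih q.2 G).

(* The coefficient of [h^l]; the tuple [p] lists [(alpha_j, beta_j)], j <= l. *)
Definition star_formula (W : mode n -> mode n -> R) (l : nat) F G : fseries :=
  (l`!%:R)^-1 *: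
  \sum_(p \in [set: l.-tuple (mode n * mode n)])
    (\prod_(q <- p) (W q.1 q.2)%:C) *:
      wick (foldr annih F [seq q.1 | q <- p]) (foldr annih G [seq q.2 | q <- p]).

Definition hida_pred : {pred fseries} :=
  fun F => `[< forall r c, 0 < r -> 0 < c -> (hnorm2 r c F < +oo)%E >].

Record hida := Hida {
  hida_val :> {mset mode n} -> R[i];
  hida_valP : (hida_val : fseries) \in hida_pred }.
HB.instance Definition _ := [isSub for hida_val : hida -> fseries].
HB.instance Definition _ := [Choice of hida by <:].

Lemma normc_ge0 (x : R[i]) : 0 <= normc x.
Proof. by case: x => u v; exact: sqrtr_ge0. Qed.

Lemma weight_ge0 r I : 0 <= weight r I.
Proof. by rewrite /weight prodr_ge0// => a _; rewrite powR_ge0. Qed.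

Lemma hterm_ge0 r c F I : 0 < c -> 0 <= hterm r c F I.
Proof.
move=> c0; rewrite /hterm mulr_ge0 ?exprn_ge0 ?(ltW c0)//.
by rewrite mulr_ge0 ?weight_ge0 ?exprn_ge0 ?normc_ge0.
Qed.

Lemma hidaP F :
  reflect (forall r c, 0 < r -> 0 < c -> (hnorm2 r c F < +oo)%E)
          (F \in hida_pred).
Proof. exact: asboolP. Qed.

Lemma esumZ_le (T : choiceType) (k : R) (f : T -> R) : 0 <= k ->
  (forall x, 0 <= f x) ->
  (\esum_(x in [set: T]) (k * f x)%:E <=
   k%:E * \esum_(x in [set: T]) (f x)%:E)%E.
Proof.
move=> k0 f0; apply: ge_ereal_sup => _ [X [finX _] <-].
rewrite fsbig_finite//=.
under eq_bigr do rewrite EFinM.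
rewrite -ge0_sume_distrr; last by move=> x _; rewrite lee_fin.
rewrite lee_wpmul2l ?lee_fin//.
by apply: esum_ge; exists X => //; rewrite fsbig_finite.
Qed.

Lemma hnorm2_le_scale r c F G (k : R) : 0 < c -> 0 <= k ->
  (forall I, hterm r c F I <= k * hterm r c G I) ->
  (hnorm2 r c F <= k%:E * hnorm2 r c G)%E.
Proof.
move=> c0 k0 le; apply: le_trans (esumZ_le k0 _); last first.
  by move=> I; exact: hterm_ge0.
by apply: le_esum => I _; rewrite lee_fin.
Qed.

Lemma normcD_sqr (x y : R[i]) :
  normc (x + y) ^+ 2 <= 2 * normc x ^+ 2 + 2 * normc y ^+ 2.
Proof.
have : normc (x + y) <= normc x + normc y by exact: le_normcD.
move: (normc_ge0 x) (normc_ge0 y) (normc_ge0 (x + y)).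
move: (normc x) (normc y) (normc (x + y)) => u v w u0 v0 w0 le.
have h : w ^+ 2 <= (u + v) ^+ 2 by nra.
apply: (le_trans h); have := sqr_ge0 (u - v); nra.
Qed.

Fact hida_submod_closed : submod_closed hida_pred.
Proof.
split=> [|k F G /hidaP FP /hidaP GP].
  apply/hidaP => r c r0 c0; rewrite /hnorm2 esum1 ?ltry// => I _.
  by rewrite /hterm normc0 expr0n/= !mul0r.
apply/hidaP => r c r0 c0.
have le I : ((hterm r c (k *: F + G) I)%:E <=
    (2 * normc k ^+ 2 * hterm r c F I)%:E + (2 * hterm r c G I)%:E)%E.
  have w0 : 0 <= weight r I * c ^+ size I.
    by rewrite mulr_ge0 ?weight_ge0// exprn_ge0// ltW.
  rewrite -EFinD lee_fin /hterm -!(mulrA _ (weight r I)).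
  apply: le_trans (ler_wpM2r w0 (normcD_sqr ((k *: F) I) (G I))) _.
  have -> : normc ((k *: F) I) = normc k * normc (F I) by exact: normcM.
  by rewrite le_eqVlt; apply/orP; left; apply/eqP; ring.
have k0 : 0 <= 2 * normc k ^+ 2 by rewrite mulr_ge0// sqr_ge0.
have h0 H I : 0 <= hterm r c H I by exact: hterm_ge0.
apply: le_lt_trans (le_esum (fun I _ => le I)) _.
rewrite esumD; [|by move=> I _; rewrite lee_fin mulr_ge0..].
rewrite lte_add_pinfty//.
- apply: le_lt_trans (esumZ_le k0 (h0 F)) _.
  by rewrite lte_mul_pinfty ?lee_fin// FP.
- apply: le_lt_trans (esumZ_le _ (h0 G)) _ => //.
  by rewrite lte_mul_pinfty ?lee_fin// GP.
Qed.

HB.instance Definition _ :=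
  GRing.isSubmodClosed.Build R[i] fseries hida_pred hida_submod_closed.
HB.instance Definition _ := [SubChoice_isSubLmodule of hida by <:].

Lemma hida_basis I : fbasis I \in hida_pred.
Proof.
apply/hidaP => r c r0 c0; rewrite /hnorm2.
have -> : (\esum_(J in [set: {mset mode n}]) (hterm r c (fbasis I) J)%:E =
  \esum_(J in [set I]) (hterm r c (fbasis I) J)%:E)%E.
  rewrite [RHS]esum_mkcond; apply: eq_esum => J _.
  case: ifPn => //; rewrite notin_setE /hterm /fbasis => /= /eqP/negPf ->.
  by rewrite normc0 expr0n/= !mul0r.
by rewrite esum_set1 ?ltry// lee_fin hterm_ge0.
Qed.

Definition hbasis I : hida := Hida (hida_basis I).

(* The decompositions [A + B] of the multiset underlying [s]: there are at
   most [2 ^ size s] of them. *)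
Fixpoint splits (s : seq (mode n)) : seq ({mset mode n} * {mset mode n}) :=
  if s is a :: s' then
    [seq (a +` p.1, p.2) | p <- splits s'] ++
    [seq (p.1, a +` p.2) | p <- splits s']
  else [:: (mset0, mset0)].

Lemma size_splits s : size (splits s) = (2 ^ size s)%N.
Proof.
elim: s => //= a s IHs.
by rewrite size_cat !size_map IHs expnS mul2n addnn.
Qed.

Lemma mem_splits s (p : {mset mode n} * {mset mode n}) :
  p.1 `+` p.2 = seq_mset s -> p \in splits s.
Proof.
elim: s p => [|a s IHs] [A B] /= /msetP E.
  have E0 b : (A b + B b = 0)%N by rewrite -msetE2 E mset_seqE.
  by rewrite inE; apply/eqP; congr pair; apply/msetP => b; rewrite mset0E;
    have := E0 b; lia.
have {}E b : (A b + B b = (a == b) + count_mem b s)%N.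
  by rewrite -msetE2 E mset_seqE.
rewrite mem_cat; case Aa : (A a) => [|m]; last first.
  apply/orP; left; apply/mapP; exists (A `\ a, B); last first.
    congr pair => /=; apply/msetP => b; rewrite mset1DE msetB1E.
    by case: eqVneq => [->|_]; rewrite ?Aa ?subn0// add1n subn1.
  apply: IHs => /=; apply/msetP => b.
  rewrite msetE2 msetB1E mset_seqE; have := E b; rewrite (eq_sym b).
  by case: eqVneq => [<-|_]; rewrite ?Aa; lia.
apply/orP; right; apply/mapP; exists (A, B `\ a); last first.
  congr pair => /=; apply/msetP => b; rewrite mset1DE msetB1E.
  have := E a; rewrite Aa eqxx.
  by case: eqVneq => [->|_]; lia.
apply: IHs => /=; apply/msetP => b.
rewrite msetE2 msetB1E mset_seqE; have := E b; have := E a.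
rewrite Aa eqxx (eq_sym b).
by case: eqVneq => [<-|_]; lia.
Qed.

Definition decomp I : set ({mset mode n} * {mset mode n}) :=
  [set p | p.1 `+` p.2 = I].

Lemma decomp_splits I : (decomp I `<=` [set` splits I])%classic.
Proof. by move=> p /= pI; apply: mem_splits; rewrite seq_mset_id. Qed.

Lemma finite_decomp I : finite_set (decomp I).
Proof. exact: sub_finite_set (@decomp_splits I) (finite_seq _). Qed.

Lemma normc_sum (T : eqType) (s : seq T) (f : T -> R[i]) :
  normc (\sum_(x <- s) f x) <= \sum_(x <- s) normc (f x).
Proof.
elim: s => [|x s IHs]; first by rewrite !big_nil normc0.
by rewrite !big_cons (le_trans (le_normcD _ _))// lerD2l.
Qed.

Lemma sqr_sum (T : eqType) (s : seq T) (f : T -> R) :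
  (\sum_(x <- s) f x) ^+ 2 <= (size s)%:R * \sum_(x <- s) f x ^+ 2.
Proof.
have E : \sum_(x <- s) \sum_(y <- s) (f x ^+ 2 + f y ^+ 2) =
    2 * ((size s)%:R * \sum_(x <- s) f x ^+ 2).
  under eq_bigr do rewrite big_split/= big_const_seq count_predT iter_addr_0.
  rewrite big_split/= big_const_seq count_predT iter_addr_0 -sumrMnl.
  by rewrite -mulr2n sumrMnl !mulr_natl.
have H : (\sum_(x <- s) f x) ^+ 2 *+ 2 <=
    \sum_(x <- s) \sum_(y <- s) (f x ^+ 2 + f y ^+ 2).
  rewrite expr2 big_distrlr/= -sumrMnl ler_sum// => x _.
  rewrite -sumrMnl ler_sum// => y _.
  by have := sqr_ge0 (f x - f y); nra.
by move: H; rewrite E -mulr_natl ler_pM2l.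
Qed.

Lemma weightD r I J : weight r (I `+` J) = weight r I * weight r J.
Proof.
rewrite /weight -big_cat/=; apply: perm_big.
by apply/allP => a _ /=; rewrite count_cat !count_mem_mset msetE2.
Qed.

Lemma size_msetD I J : size (I `+` J) = (size I + size J)%N.
Proof.
rewrite -size_cat; apply: perm_size.
by apply/allP => a _ /=; rewrite count_cat !count_mem_mset msetE2.
Qed.

Lemma hterm_wick r c F G I : 0 < c ->
  ((hterm r c (wick F G) I)%:E <=
   \esum_(p in decomp I) (hterm r (2 * c) F p.1 * hterm r (2 * c) G p.2)%:E)%E.
Proof.
move=> c0; have fin := finite_decomp I.
have c2 : 0 < 2 * c by rewrite mulr_gt0.
rewrite esum_fset//; last first.
  by move=> p _; rewrite lee_fin mulr_ge0 ?hterm_ge0.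
rewrite fsbig_finite//= sumEFin lee_fin {1}/hterm /wick -/(decomp I).
rewrite fsbig_finite//=; set s := fset_set _.
have sz : (size s <= 2 ^ size I)%N.
  rewrite -size_splits; apply: uniq_leq_size; first exact: fset_uniq.
  move=> p; rewrite in_fset_set// inE => /decomp_splits; exact.
have le : normc (\sum_(p <- s) F p.1 * G p.2) ^+ 2 <=
    (2 ^+ size I) * \sum_(p <- s) (normc (F p.1) * normc (G p.2)) ^+ 2.
  have h : normc (\sum_(p <- s) F p.1 * G p.2) ^+ 2 <=
      (\sum_(p <- s) normc (F p.1) * normc (G p.2)) ^+ 2.
    rewrite lerXn2r ?nnegrE ?normc_ge0//.
      by rewrite sumr_ge0// => p _; rewrite mulr_ge0 ?normc_ge0.
    apply: le_trans (normc_sum _ _) _.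
    by rewrite ler_sum// => p _; rewrite normcM.
  apply: (le_trans h); apply: (le_trans (sqr_sum _ _)).
  rewrite ler_wpM2r ?sumr_ge0// => [p _|]; first exact: sqr_ge0.
  by rewrite -natrX ler_nat.
apply: (@le_trans _ _ ((2 ^+ size I *
    \sum_(p <- s) (normc (F p.1) * normc (G p.2)) ^+ 2) *
    weight r I * c ^+ size I)).
  by rewrite ler_wpM2r ?exprn_ge0 ?(ltW c0)// ler_wpM2r ?weight_ge0.
rewrite mulr_sumr !mulr_suml big_seq [leRHS]big_seq ler_sum// => p.
rewrite in_fset_set// inE => <-.
rewrite /hterm weightD size_msetD !exprMn !exprD le_eqVlt; apply/orP; left.
by apply/eqP; ring.
Qed.

Lemma hnorm2_ge0 r c F : 0 < c -> (0 <= hnorm2 r c F)%E.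
Proof. by move=> c0; apply: esum_ge0 => I _; rewrite lee_fin hterm_ge0. Qed.

Lemma hnorm2_wick r c F G : 0 < c ->
  (hnorm2 r (2 * c) F < +oo)%E -> (hnorm2 r (2 * c) G < +oo)%E ->
  (hnorm2 r c (wick F G) <= hnorm2 r (2 * c) F * hnorm2 r (2 * c) G)%E.
Proof.
move=> c0 Ffin Gfin.
have c2 : 0 < 2 * c by rewrite mulr_gt0.
pose f := hterm r (2 * c) F; pose g := hterm r (2 * c) G.
have f0 I : 0 <= f I by exact: hterm_ge0.
have g0 I : 0 <= g I by exact: hterm_ge0.
apply: (@le_trans _ _ (\esum_(I in [set: {mset mode n}])
   \esum_(p in decomp I) (f p.1 * g p.2)%:E)%E).
  by apply: le_esum => I _; exact: hterm_wick.
rewrite esum_esum; last by move=> I p _ _; rewrite lee_fin mulr_ge0.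
have bij : set_bij ([set: {mset mode n}] `*`` decomp)
    [set: {mset mode n} * {mset mode n}] snd.
  split=> [//|[I p] [J q]|p _]; last by exists (p.1 `+` p.2, p).
  by rewrite !inE/= => -[_ <-] [_ <-] ->.
rewrite -(@reindex_esum R _ _ _ _ _ (fun p => (f p.1 * g p.2)%:E) bij).
have -> : [set: {mset mode n} * {mset mode n}] =
    [set: {mset mode n}] `*`` (fun=> [set: {mset mode n}]).
  by apply/seteqP; split.
rewrite -(esum_esum (a := fun A B => (f A * g B)%:E)); last first.
  by move=> A B _ _; rewrite lee_fin mulr_ge0.
have Gf : hnorm2 r (2 * c) G \is a fin_num by rewrite ge0_fin_numE ?hnorm2_ge0.
have E : hnorm2 r (2 * c) G = (fine (hnorm2 r (2 * c) G))%:E by rewrite fineK.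
have m0 : 0 <= fine (hnorm2 r (2 * c) G) by rewrite fine_ge0// hnorm2_ge0.
rewrite muleC E; apply: le_trans (esumZ_le m0 f0).
apply: le_esum => A _; rewrite mulrC EFinM -E.
exact: esumZ_le.
Qed.

Lemma hida_wick F G :
  F \in hida_pred -> G \in hida_pred -> wick F G \in hida_pred.
Proof.
move=> /hidaP FP /hidaP GP; apply/hidaP => r c r0 c0.
have c2 : 0 < 2 * c by rewrite mulr_gt0.
apply: le_lt_trans (hnorm2_wick c0 (FP _ _ r0 c2) (GP _ _ r0 c2)) _.
by rewrite lte_mul_pinfty ?GP ?hnorm2_ge0// ge0_fin_numE ?FP ?hnorm2_ge0.
Qed.

Definition hwick (F G : hida) : hida :=
  Hida (hida_wick (hida_valP F) (hida_valP G)).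

Definition hone : hida := hbasis mset0.

Definition hnorm r c (F : hida) : R := Num.sqrt (fine (hnorm2 r c F)).

End FockSeries.

Section StarProduct.
Variables (R : realType) (n : nat).
Notation W := (hida R n).
Implicit Types (F G H : W) (B br : W -> W -> W).

Definition tame_estimate B : Prop :=
  forall r c : R, 0 < r -> 0 < c ->
  exists r1 c1 K : R, [/\ 0 < r1, 0 < c1 &
    forall F G, hnorm r c (B F G) <= K * hnorm r1 c1 F * hnorm r1 c1 G].

Record poisson_structure br : Prop := {
  poisson_linearl : forall G, linear (br^~ G);
  poisson_linearr : forall F, linear (br F);
  poisson_antisym : forall F G, br F G = - br G F;
  poisson_jacobi : forall F G H,
    br F (br G H) + br G (br H F) + br H (br F G) = 0;
  poisson_derivl : forall F G H,
    br (hwick F G) H = hwick F (br G H) + hwick (br F H) G;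
  poisson_derivr : forall F G H,
    br F (hwick G H) = hwick (br F G) H + hwick G (br F H);
  poisson_one : forall F, br (hone R n) F = 0;
  poisson_continuous : tame_estimate br }.

(* [W[[h]]] is [nat -> W] and [C[[h]]] is [nat -> R[i]]: the family [u] stands
   for [\sum_l h^l u_l]. *)
Definition hconst F : nat -> W := fun l => if l is 0 then F else 0.

Definition hscale (k : nat -> R[i]) (u : nat -> W) : nat -> W :=
  fun l => \sum_(i < l.+1) k i *: u (l - i)%N.

(* [P_l] is recovered as the coefficient of [h^l] in the product of two
   constant series.  Bilinearity over [C[[h]]] determines the whole product from
   the [P_l]: modulo [h^l] every series is a [C[[h]]]-combination of constant
   ones. *)
Definition star_coef (star : (nat -> W) -> (nat -> W) -> (nat -> W))
  (l : nat) F G : W := star (hconst F) (hconst G) l.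

Record star_product br (star : (nat -> W) -> (nat -> W) -> (nat -> W)) : Prop := {
  star_addl : forall u v w, star (u + v) w = star u w + star v w;
  star_addr : forall u v w, star u (v + w) = star u v + star u w;
  star_scalel : forall k u v, star (hscale k u) v = hscale k (star u v);
  star_scaler : forall k u v, star u (hscale k v) = hscale k (star u v);
  star_coef0 : forall F G, star_coef star 0 F G = hwick F G;
  star_coef1 : forall F G,
    star_coef star 1 F G - star_coef star 1 G F = 2%:R *: br F G;
  star_continuous : forall l, tame_estimate (star_coef star l);
  star_constl : forall l (k : R[i]) F,
    (0 < l)%N -> star_coef star l (k *: hone R n) F = 0;
  star_constr : forall l (k : R[i]) F,
    (0 < l)%N -> star_coef star l F (k *: hone R n) = 0;
  star_assoc : forall F G H,
    star (hconst F) (star (hconst G) (hconst H)) =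
    star (star (hconst F) (hconst G)) (hconst H) }.

End StarProduct.

(* Main.v *)
Require Import Defs.
From HB Require Import structures.
From mathcomp Require Import all_boot all_order all_algebra.
From mathcomp Require Import finmap multiset complex.
From mathcomp Require Import all_classical all_reals all_analysis.
From mathcomp Require Import zify ring lra.

Set Implicit Arguments.
Unset Strict Implicit.
Unset Printing Implicit Defensive.

Import Order.TTheory GRing.Theory Num.Theory.
Import numFieldNormedType.Exports Normc.
Local Open Scope ring_scope.

(** Write [x_a] for the generator of the mode [a].  Finite sums are then polynomials in the
    variables [x_a], the Wick product is the product of polynomials, the annihilation
    operators are the partial derivatives, and the star-product is the Moyal product with
    constant structure matrix [W], the inverse of the matrix of [Omega].

    Analysis.  The Hida weights are replaced by the powers of one multiplicative function
    [growth].  The space is nuclear ([sum_growth_nuclear]), so its topology is given by the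
    [l^1] seminorms of weight [growth ^+ m] ([hida_predP], [bounded_tame_estimate]).  For
    these a linear operator is tame as soon as its values at the monomials are bounded by a
    power of [growth]; it then extends uniquely from finite sums to the whole space
    ([extension_tame_linear], [tame_linear_eq]).

    Algebra.  The coefficients [P_l] of the Moyal product satisfy the recursion
      [P_(l+1) (x_a F, G) = x_a P_(l+1) (F, G) + sum_b W a b P_l (F, d_b G)]
    ([contract_mulmode]).  The matrix [W] preserves frequencies and grows like the
    eigenvalue of the frequency, hence at most like [growth]; by induction on monomials the
    recursion gives an estimate of [P_l (F, G)] in terms of [l] derivatives of [G] only
    ([star_formula_l1_le]), which defines [P_l] on the whole space ([moyal]).  There the
    recursion persists ([moyal_mulmode]), and the identities follow from it by induction on
    the monomials of the left argument and density: the derivatives are derivations of the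
    star-product ([hannih_moyal]), and the product is associative ([moyal_assoc]).  The
    Poisson bracket is [P_1]; it is antisymmetric as [W] is, and its Jacobi identity is the
    part of order [h^2] of associativity ([moyal1_jacobi]).

    The matrix of [Omega].  The Fourier basis is orthogonal for the integral over the circle
    ([harmonic_orthogonal]), so the matrix is block diagonal, with blocks proportional to
    the matrix of the form [om]; it is inverted block by block, and its inverse is unique
    because all rows and columns are finitely supported ([Omega_inverse_unique]). *)

(** * Words and finite sums *)

Section FiniteSums.
Variable R : realType.

Lemma ler_sum_uniq (T : eqType) (f : T -> R) (s t : seq T) :
  (forall x, 0 <= f x) -> uniq s -> {subset s <= t} ->
  \sum_(x <- s) f x <= \sum_(x <- t) f x.
Proof.
move=> f0; elim: s t => [|x s IHs] t /=; first by rewrite big_nil sumr_ge0.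
move=> /andP[xs us] st; have xt : x \in t by apply: st; rewrite mem_head.
rewrite big_cons (perm_big _ (perm_to_rem xt)) big_cons/= lerD2l; apply: IHs => // y ys.
have : y \in t by apply: st; rewrite inE ys orbT.
rewrite (perm_mem (perm_to_rem xt)) inE => /predU1P[yx|//].
by rewrite -yx ys in xs.
Qed.

End FiniteSums.

Section Words.

Fixpoint words (T : Type) (t : seq T) (l : nat) : seq (seq T) :=
  if l is l'.+1 then [seq a :: w | a <- t, w <- words t l'] else [:: [::]].

Lemma mem_words (T : eqType) (t : seq T) l w :
  (w \in words t l) = (size w == l) && all (mem t) w.
Proof.
elim: l w => [|l IHl] [|a w]/=; rewrite ?inE//.
  by apply/negbTE/allpairsP => -[[? ?] []].
apply/allpairsP/idP => [[[b v]/= [bt]]|/and3P[sw at_ aw]].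
  by rewrite IHl => /andP[sv av] [-> ->]; rewrite eqSS sv/= bt.
by exists (a, w); rewrite IHl -eqSS sw aw.
Qed.

Lemma uniq_words (T : eqType) (t : seq T) l : uniq t -> uniq (words t l).
Proof.
move=> ut; elim: l => //= l IHl; apply: allpairs_uniq => //.
by move=> [a v] [b w] _ _ /= [-> ->].
Qed.

Lemma sum_words (R : comNzRingType) (T : eqType) (x : T -> R) t l :
  \sum_(w <- words t l) \prod_(a <- w) x a = (\sum_(a <- t) x a) ^+ l.
Proof.
elim: l => [|l IHl] /=; first by rewrite big_seq1 big_nil.
rewrite big_allpairs_dep/= exprS -IHl big_distrl/=; apply: eq_bigr => a _.
by rewrite big_distrr/=; apply: eq_bigr => w _; rewrite big_cons.
Qed.

End Words.

Section Multisets.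
Variable K : choiceType.
Local Open Scope mset_scope.

Lemma mset_ind (P : {mset K} -> Prop) :
  P mset0 -> (forall a I, P I -> P (a +` I)) -> forall I, P I.
Proof.
move=> P0 PS I; rewrite -(seq_mset_id I); elim: (I : seq K) => [|a s IHs].
  by have -> : seq_mset [::] = mset0 :> {mset K}
    by apply/msetP => b; rewrite mset_seqE mset0E.
by rewrite mset_cons; exact: PS.
Qed.

End Multisets.

(** * Growth of the weights and nuclearity *)

Section Growth.
Variables (R : realType) (n : nat).
Local Open Scope mset_scope.
Implicit Types (a : mode n) (I J : {mset mode n}).

Lemma symb_ge1 k : 1 <= symb R k.
Proof. by rewrite /symb lerDr mulr_ge0 ?sqr_ge0// mulr_ge0// sqr_ge0. Qed.

(** The factor [2] makes the powers of [growth] absorb any geometric factor [c ^+ size I],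
    so that one integer parameter replaces the two parameters of the Hilbert norms. *)
Definition mode_growth a : R := 2 * symb R a.1.

Definition growth I : R := \prod_(a <- I) mode_growth a.

Lemma mode_growth_ge2 a : 2 <= mode_growth a.
Proof. by rewrite /mode_growth ler_peMr// symb_ge1. Qed.

Lemma mode_growth_gt0 a : 0 < mode_growth a.
Proof. by rewrite (lt_le_trans _ (mode_growth_ge2 a)). Qed.

Lemma growth_mset0 : growth mset0 = 1.
Proof. by rewrite /growth big_mset0. Qed.

Lemma growthD I J : growth (I `+` J) = growth I * growth J.
Proof.
rewrite /growth -big_cat/=; apply: perm_big.
by apply/allP => a _ /=; rewrite count_cat !count_mem_mset msetE2.
Qed.

Lemma growth_mset1 a : growth [mset a] = mode_growth a.
Proof. by rewrite /growth big_msetn. Qed.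

Lemma growth1D a I : growth (a +` I) = mode_growth a * growth I.
Proof. by rewrite growthD growth_mset1. Qed.

Lemma growth_ge_size I : 2 ^+ size I <= growth I.
Proof.
rewrite /growth; elim: (I : seq _) => [|a s IHs] /=; first by rewrite big_nil.
by rewrite big_cons exprS ler_pM ?mode_growth_ge2// exprn_ge0.
Qed.

Lemma growth_ge1 I : 1 <= growth I.
Proof. by rewrite (le_trans _ (growth_ge_size I))// exprn_ege1// ler1n. Qed.

Lemma growth_gt0 I : 0 < growth I.
Proof. by rewrite (lt_le_trans _ (growth_ge1 I)). Qed.

Lemma growthX_gt0 I m : 0 < growth I ^+ m.
Proof. by rewrite exprn_gt0// growth_gt0. Qed.

Lemma growth_leX I m m' : (m <= m')%N -> growth I ^+ m <= growth I ^+ m'.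
Proof. by move=> ?; rewrite ler_weXn2l// growth_ge1. Qed.

Lemma multiplicity_le_growth a I : (I a)%:R <= growth I.
Proof.
apply: le_trans (growth_ge_size I); rewrite -natrX ler_nat -count_mem_mset.
by apply: (leq_trans (count_size _ _)); rewrite ltnW// ltn_expl.
Qed.

(** Comparing the sum over multisets with the geometric series of the sums
    over words: every multiset is the underlying multiset of a word. *)
Lemma sum_mset_prod_le2 (x : mode n -> R) : (forall a, 0 <= x a) ->
  (forall t, uniq t -> \sum_(a <- t) x a <= 2^-1) ->
  forall s : seq {mset mode n}, uniq s -> \sum_(I <- s) \prod_(a <- (I : {mset _})) x a <= 2.
Proof.
move=> x0 xle s us.
pose t := undup (flatten (map (@enum_mset (mode n)) s)).
pose M := \max_(I <- s) size (I : {mset mode n}).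
pose W := flatten [seq words t l | l <- iota 0 M.+1].
have -> : \sum_(I <- s) \prod_(a <- (I : {mset _})) x a =
    \sum_(w <- (map (@enum_mset (mode n)) s)) \prod_(a <- w) x a.
  by rewrite big_map.
apply: (@le_trans _ _ (\sum_(w <- W) \prod_(a <- w) x a)).
  apply: ler_sum_uniq; first by move=> w; rewrite prodr_ge0.
    rewrite map_inj_uniq// => I J IJ.
    by rewrite -[I]seq_mset_id -[J]seq_mset_id IJ.
  move=> _ /mapP[I Is ->]; apply/flattenP; exists (words t (size (I : {mset mode n}))).
    apply/mapP; exists (size (I : {mset mode n})) => //; rewrite mem_iota/= add0n ltnS /M.
    by rewrite (big_rem I)//= leq_maxl.
  rewrite mem_words eqxx/=; apply/allP => a aI /=; rewrite mem_undup.
  by apply/flattenP; exists (enum_mset I) => //; exact: map_f.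
rewrite big_flatten big_map.
under eq_bigr do rewrite sum_words.
have x_ge0 : 0 <= \sum_(a <- t) x a by rewrite sumr_ge0.
apply: (@le_trans _ _ (\sum_(l <- iota 0 M.+1) 2^-1 ^+ l)).
  by rewrite ler_sum// => l _; rewrite lerXn2r ?nnegrE ?invr_ge0// xle// undup_uniq.
have -> : \sum_(l <- iota 0 M.+1) 2^-1 ^+ l = 2 - 2^-1 ^+ M :> R.
  elim: (M) => [|N IHN]; first by rewrite big_seq1 expr0; lra.
  by rewrite -[N.+2]addn1 iotaD big_cat/= IHN big_seq1 add0n exprS; lra.
by rewrite lerBlDr lerDl exprn_ge0.
Qed.

(** Since [2 (4 pi^2 k^2 + 1) >= (1 + |k|)^2], the frequencies of each sign contribute at most
    the sum of the inverse squares, which telescoping bounds by [2]. *)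
Lemma sum_inv_mode_growth (t : seq (mode n)) : uniq t ->
  \sum_(a <- t) (mode_growth a)^-1 <= 4 * n%:R.
Proof.
move=> ut; pose N := \max_(a <- t) absz a.1.
pose ks := [seq Posz j | j <- iota 0 N.+1] ++ [seq Negz j | j <- iota 0 N.+1].
pose f (k : int) : R := (2 * symb R k)^-1.
have f0 k : 0 <= f k.
  by rewrite /f invr_ge0 mulr_ge0// (le_trans _ (symb_ge1 k)).
have fle k j : (j.+1%:R <= 1 + `|k%:~R| :> R) -> f k <= j.+1%:R ^- 2.
  move=> jk; rewrite /f lef_pV2 ?posrE ?exprn_gt0//; last first.
    by rewrite mulr_gt0// (lt_le_trans _ (symb_ge1 k)).
  have k0 : 0 <= `|k%:~R| :> R by [].
  have j0 : 0 <= j.+1%:R :> R by [].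
  have p2 := pi_ge2 R; rewrite /symb -[k%:~R ^+ 2]real_normK ?num_real//.
  set p := pi in p2 *; set y := `|_| in jk k0 *; set z := j.+1%:R in jk j0 *.
  have pp : 1 <= p ^+ 2 by nra.
  have zz : z ^+ 2 <= (1 + y) ^+ 2 by nra.
  have yy : 0 <= y ^+ 2 by nra.
  have := sqr_ge0 (y - 1); nra.
have inv_sq : \sum_(j <- iota 0 N.+1) j.+1%:R ^- 2 <= 2 :> R.
  suff H M : \sum_(j <- iota 0 M.+1) j.+1%:R ^- 2 <= 2 - M.+1%:R^-1 :> R.
    by apply: (le_trans (H N)); rewrite lerBlDr lerDl invr_ge0.
  elim: M => [|M IHM]; first by rewrite big_seq1 invr1; lra.
  rewrite -[M.+2]addn1 iotaD big_cat/= big_seq1 add0n.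
  apply: (le_trans (lerD IHM (lexx _))); rewrite -addrA lerD2l.
  rewrite natrD -(natr1 M.+1); set z : R := M.+1%:R.
  have z0 : 0 < z by rewrite ltr0n.
  have -> : - z^-1 + (z + 1) ^- 2 = - (z + 1)^-1 - (z * (z + 1) ^+ 2)^-1.
    by field; rewrite !gt_eqF// addr_gt0.
  by rewrite gerDl oppr_le0 invr_ge0 ltW// mulr_gt0// exprn_gt0// addr_gt0.
have -> : 4 * n%:R = \sum_(i <- enum 'I_n) 4 :> R.
  by rewrite big_const_seq count_predT size_enum_ord iter_addr_0 mulr_natr.
apply: (@le_trans _ _ (\sum_(a <- [seq (k, i) | k <- ks, i <- enum 'I_n]) f a.1)).
  apply: ler_sum_uniq => // [a|[k i] at_]; first exact: f0.
  apply/allpairsP; exists (k, i).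
  rewrite mem_enum; split=> //=; rewrite mem_cat.
  have kN : (`|k| <= N)%N by rewrite /N (big_rem _ at_)/= leq_maxl.
  case: k kN {at_} => j jN; apply/orP; [left|right]; apply: map_f.
    by rewrite mem_iota/= add0n ltnS.
  by rewrite mem_iota/= add0n ltnS ltnW.
rewrite big_allpairs_dep/= exchange_big/= ler_sum// => i _.
rewrite /ks big_cat !big_map; have -> : 4 = 2 + 2 :> R by lra.
apply: lerD; apply: le_trans inv_sq; apply: ler_sum => j _; apply: fle.
  by rewrite normr_nat -natr1; lra.
by rewrite NegzE rmorphN/= normrN normr_nat -!natr1; lra.
Qed.

(** Nuclearity of the Hida space: raising the weight by a fixed power is enough to pass
    from a supremum to a sum.  The eigenvalues grow quadratically, so their inverses are
    summable, and a further power makes the sum over the modes at most [1/2]. *)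
Lemma sum_growth_nuclear : exists k : nat, forall s : seq {mset mode n}, uniq s ->
  \sum_(I <- s) growth I ^- k <= 2.
Proof.
have [k' Hk] : exists k : nat, (4 * n%:R) * 2^-1 ^+ k <= 2^-1 :> R.
  have [k Hk] : exists k : nat, 8 * n%:R <= 2 ^+ k :> R.
    exists (8 * n)%N; rewrite -natrM -natrX ler_nat ltnW// ltn_expl//.
  exists k; rewrite exprVn ler_pdivrMr ?exprn_gt0//; lra.
exists k'.+1 => s us.
have -> : \sum_(I <- s) growth I ^- k'.+1 =
    \sum_(I <- s) \prod_(a <- (I : {mset mode n})) mode_growth a ^- k'.+1.
  apply: eq_bigr => I _; rewrite /growth; elim: (I : seq _) => [|a w IHw].
    by rewrite !big_nil expr1n invr1.
  by rewrite !big_cons exprMn invfM IHw.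
apply: sum_mset_prod_le2 => // [a|t ut].
  by rewrite invr_ge0 exprn_ge0// ltW// mode_growth_gt0.
apply: le_trans Hk; apply: le_trans (ler_wpM2r _ (sum_inv_mode_growth ut)).
  rewrite mulr_suml ler_sum// => a _; rewrite exprS invfM ler_wpM2l//.
    by rewrite invr_ge0 ltW// mode_growth_gt0.
  rewrite -exprVn lerXn2r ?nnegrE ?invr_ge0 ?(ltW (mode_growth_gt0 a))//.
  by rewrite lef_pV2 ?posrE ?mode_growth_gt0 ?mode_growth_ge2.
by rewrite exprn_ge0.
Qed.

End Growth.

(** * Unconditional sums of complex families *)

Section UnconditionalSums.
Variables (R : realType) (T : choiceType).
Local Open Scope complex_scope.
Implicit Types (f g : T -> R[i]) (S : R[i]).

(** Unconditional convergence, along the finite sets of indices. *)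
Definition has_sum f S := forall e : R, 0 < e -> exists s0 : seq T,
  forall s, uniq s -> {subset s0 <= s} -> normc (\sum_(x <- s) f x - S) <= e.

Definition abs_bounded f (K : R) :=
  forall s, uniq s -> \sum_(x <- s) normc (f x) <= K.

Definition csum f : R[i] := xget 0 [set S | has_sum f S]%classic.

Lemma normc_real (x : R) : normc x%:C = `|x|.
Proof. by rewrite /normc/= expr0n/= addr0 sqrtr_sqr. Qed.

Lemma normc_subadd (x y z : R[i]) : normc (x - z) <= normc (x - y) + normc (y - z).
Proof. by apply: le_trans (le_normcD _ _); rewrite addrA subrK. Qed.

Lemma has_sum_unique f S S' : has_sum f S -> has_sum f S' -> S = S'.
Proof.
move=> HS HS'; apply/eqP; rewrite -subr_eq0; apply/eqP/eq0_normc/eqP.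
rewrite eq_le normc_ge0 andbT; apply/ler_addgt0Pr => e e0.
have e2 : 0 < e / 2 by rewrite divr_gt0.
have [s1 H1] := HS _ e2; have [s2 H2] := HS' _ e2.
pose s := undup (s1 ++ s2).
have u1 : normc (\sum_(x <- s) f x - S) <= e / 2.
  by apply: H1; rewrite ?undup_uniq// => x x1; rewrite mem_undup mem_cat x1.
have u2 : normc (\sum_(x <- s) f x - S') <= e / 2.
  by apply: H2; rewrite ?undup_uniq// => x x1; rewrite mem_undup mem_cat x1 orbT.
apply: (le_trans (normc_subadd _ (\sum_(x <- s) f x) _)).
by rewrite add0r (splitr e) lerD// -normcN opprB.
Qed.

Lemma csumE f S : has_sum f S -> csum f = S.
Proof.
by move=> HS; apply: has_sum_unique (HS); rewrite /csum; case: xgetP => [y -> //|/(_ S)].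
Qed.

Lemma has_sumD f g S S' : has_sum f S -> has_sum g S' ->
  has_sum (fun x => f x + g x) (S + S').
Proof.
move=> HS HS' e e0; have e2 : 0 < e / 2 by rewrite divr_gt0.
have [s1 H1] := HS _ e2; have [s2 H2] := HS' _ e2.
exists (s1 ++ s2) => s us ss; rewrite big_split/= opprD addrACA.
apply: (le_trans (le_normcD _ _)); rewrite (splitr e) lerD//.
  by apply: H1 => // x x1; apply: ss; rewrite mem_cat x1.
by apply: H2 => // x x1; apply: ss; rewrite mem_cat x1 orbT.
Qed.

Lemma has_sumZ f S (k : R[i]) : has_sum f S -> has_sum (fun x => k * f x) (k * S).
Proof.
move=> HS e e0; have k0 : 0 < normc k + 1 by rewrite ltr_wpDl// normc_ge0.
have [s1 H1] := HS _ (divr_gt0 e0 k0); exists s1 => s us ss.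
rewrite -big_distrr/= -mulrBr normcM.
apply: (le_trans (ler_wpM2l (normc_ge0 k) (H1 s us ss))).
by rewrite mulrCA ger_pMr// ler_pdivrMr// mul1r lerDl.
Qed.

Lemma has_sum_nonneg (g : T -> R) K : (forall x, 0 <= g x) ->
  (forall s, uniq s -> \sum_(x <- s) g x <= K) ->
  exists S : R, has_sum (fun x => (g x)%:C) S%:C.
Proof.
move=> g0 gK.
pose E := [set y : R | exists2 s : seq T, uniq s & y = \sum_(x <- s) g x]%classic.
have supE : has_sup E.
  split; first by exists 0, [::]; rewrite ?big_nil.
  by exists K => _ [s us ->]; exact: gK.
exists (sup E) => e e0; have [_ [s0 us0 ->] Hs0] := sup_adherent e0 supE.
exists s0 => s us ss; rewrite -rmorph_sum -rmorphB normc_real ler_distl.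
have le0 : \sum_(x <- s0) g x <= \sum_(x <- s) g x by exact: ler_sum_uniq.
have le1 : \sum_(x <- s) g x <= sup E by apply: ub_le_sup; [case: supE|exists s].
lra.
Qed.

(** The real and the imaginary part are differences [(g + |g|) - |g|] of families of
    nonnegative reals, whose sum is the supremum of the finite ones. *)
Lemma abs_bounded_has_sum f K : abs_bounded f K -> exists S, has_sum f S.
Proof.
have real (g : T -> R) : (forall s, uniq s -> \sum_(x <- s) `|g x| <= K) ->
    exists S, has_sum (fun x => (g x)%:C) S.
  move=> gK; have [S HS] := has_sum_nonneg (fun x => normr_ge0 (g x)) gK.
  have [|s us|S' HS'] := @has_sum_nonneg (fun x => g x + `|g x|) (K + K).
  - by move=> x; have := ler_norm (- g x); rewrite normrN; lra.
  - by rewrite big_split/= lerD ?gK// (le_trans _ (gK s us))// ler_sum// => x _; rewrite ler_norm.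
  exists (S'%:C + (-1) * S%:C).
  have -> : (fun x => (g x)%:C) = (fun x => (g x + `|g x|)%:C + (-1) * `|g x|%:C).
    by apply/funext => x; rewrite rmorphD/=; ring.
  by apply: has_sumD => //; exact: has_sumZ.
move=> fK.
have [s us|S HS] := real (fun x => complex.Re (f x)).
  apply: le_trans (fK s us); apply: ler_sum => x _; case: (f x) => u v /=.
  by rewrite -sqrtr_sqr ler_sqrt ?lerDl ?addr_ge0 ?sqr_ge0.
have [s us|S' HS'] := real (fun x => complex.Im (f x)).
  apply: le_trans (fK s us); apply: ler_sum => x _; case: (f x) => u v /=.
  by rewrite -sqrtr_sqr ler_sqrt ?lerDr ?addr_ge0 ?sqr_ge0.
exists (S + 'i * S').
have -> : f = fun x => (complex.Re (f x))%:C + 'i * (complex.Im (f x))%:C.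
  by apply/funext => x; exact: complexE.
by apply: has_sumD => //; exact: has_sumZ.
Qed.

Lemma csumP f K : abs_bounded f K -> has_sum f (csum f).
Proof. by move=> /abs_bounded_has_sum[S HS]; rewrite (csumE HS). Qed.

Lemma has_sum_finite f s : uniq s -> (forall x, x \notin s -> f x = 0) ->
  has_sum f (\sum_(x <- s) f x).
Proof.
move=> us f0 e e0; exists s => t ut st.
have -> : \sum_(x <- t) f x = \sum_(x <- s) f x.
  rewrite (bigID (mem s))/= [X in _ + X]big1 ?addr0; last by move=> x; exact: f0.
  rewrite -big_filter; apply: perm_big; apply: uniq_perm => //.
    exact: filter_uniq.
  by move=> x; rewrite mem_filter andb_idr//; exact: st.
by rewrite subrr normc0 ltW.
Qed.

Lemma has_sum_sum (J : Type) (js : seq J) (F : J -> T -> R[i]) (S : J -> R[i]) :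
  (forall j, has_sum (F j) (S j)) ->
  has_sum (fun x => \sum_(j <- js) F j x) (\sum_(j <- js) S j).
Proof.
move=> HS; elim: js => [|j js IHjs].
  under eq_fun do rewrite big_nil.
  rewrite big_nil => e e0; exists [::] => s _ _.
  by rewrite big1// subrr normc0 ltW.
under eq_fun do rewrite big_cons.
by rewrite big_cons; exact: has_sumD.
Qed.

(** The approximating sets of finitely many sums can be merged; this reduces estimates on
    the coefficients of a series to estimates on finite sums. *)
Lemma has_sum_common (J : eqType) (F : J -> T -> R[i]) (S : J -> R[i]) (js : seq J) e :
  0 < e -> (forall j, has_sum (F j) (S j)) ->
  exists2 s, uniq s & forall j, j \in js -> normc (\sum_(x <- s) F j x - S j) <= e.
Proof.
move=> e0 HS.
suff [s0 H0] : exists s0 : seq T, forall s, uniq s -> {subset s0 <= s} ->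
    forall j, j \in js -> normc (\sum_(x <- s) F j x - S j) <= e.
  exists (undup s0); first exact: undup_uniq.
  by apply: H0 => [|x]; rewrite ?undup_uniq ?mem_undup.
elim: js => [|j js [s1 H1]]; first by exists [::].
have [s2 H2] := HS j _ e0; exists (s1 ++ s2) => s us ss k.
rewrite inE => /predU1P[->|kj].
  by apply: H2 => // x x2; apply: ss; rewrite mem_cat x2 orbT.
by apply: H1 => // x x1; apply: ss; rewrite mem_cat x1.
Qed.

End UnconditionalSums.

(** * The topology of the Hida space by weighted summability *)

Section Seminorms.
Variables (R : realType) (n : nat).
Local Open Scope mset_scope.
Local Open Scope complex_scope.
Implicit Types (F G : fseries R n) (I J : {mset mode n}) (m : nat).

(** The [l^1] seminorm of weight [growth ^+ m], through its upper bounds. *)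
Definition l1_le m F (K : R) := forall s : seq {mset mode n}, uniq s ->
  \sum_(I <- s) normc (F I) * growth R I ^+ m <= K.

Lemma l1_term_ge0 m F I : 0 <= normc (F I) * growth R I ^+ m.
Proof. by rewrite mulr_ge0 ?normc_ge0// ltW// growthX_gt0. Qed.

Lemma l1_le_ge0 m F K : l1_le m F K -> 0 <= K.
Proof. by move=> /(_ [::] isT); rewrite big_nil. Qed.

Lemma l1_le_coef m F K I : l1_le m F K -> normc (F I) * growth R I ^+ m <= K.
Proof. by move=> /(_ [:: I] isT); rewrite big_seq1. Qed.

Lemma l1_le_trans m F K K' : K <= K' -> l1_le m F K -> l1_le m F K'.
Proof. by move=> KK FK s us; exact: le_trans (FK s us) KK. Qed.

Lemma l1_le_weight m m' F K : (m <= m')%N -> l1_le m' F K -> l1_le m F K.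
Proof.
move=> mm FK s us; apply: le_trans (FK s us); apply: ler_sum => I _.
by rewrite ler_wpM2l ?normc_ge0// growth_leX.
Qed.

Lemma l1_le0 m : l1_le m 0 0.
Proof. by move=> s us; rewrite big1// => I _; rewrite normc0 mul0r. Qed.

Lemma l1_leD m F G K L : l1_le m F K -> l1_le m G L -> l1_le m (F + G) (K + L).
Proof.
move=> FK GL s us; apply: le_trans (lerD (FK s us) (GL s us)).
rewrite -big_split; apply: ler_sum => I _ /=.
by rewrite -mulrDl ler_wpM2r ?le_normcD// ltW// growthX_gt0.
Qed.

Lemma l1_leZ m F K (k : R[i]) : l1_le m F K -> l1_le m (k *: F) (normc k * K).
Proof.
move=> FK s us; apply: le_trans (ler_wpM2l (normc_ge0 k) (FK s us)).
by rewrite big_distrr/=; apply: ler_sum => I _; rewrite normcM mulrA.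
Qed.

Lemma l1_le_sum m (T : Type) (ts : seq T) (F : T -> fseries R n) (K : T -> R) :
  (forall t, l1_le m (F t) (K t)) -> l1_le m (\sum_(t <- ts) F t) (\sum_(t <- ts) K t).
Proof.
move=> FK; elim: ts => [|t ts IH]; first by rewrite !big_nil; exact: l1_le0.
by rewrite !big_cons; exact: l1_leD.
Qed.

(** The parameters [(4 m, 4 ^ m)] are those for which the Hilbert weight is the square of
    the [l^1] weight. *)
Lemma sqr_l1_term m F I :
  hterm (4 * m)%:R (4 ^+ m) F I = (normc (F I) * growth R I ^+ m) ^+ 2.
Proof.
rewrite /hterm exprMn -mulrA; congr *%R; rewrite /weight /growth.
elim: (I : seq _) => [|a s IHs] /=; first by rewrite !big_nil !expr1n mulr1.
rewrite !big_cons exprS mulrACA IHs [in RHS]exprMn [in RHS]exprMn; congr *%R.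
have s1 := symb_ge1 R a.1; have s0 : 0 <= symb R a.1 by rewrite (le_trans _ s1).
rewrite powR_mulrn ?sqrtr_ge0// (_ : 4 * m = 2 * (2 * m))%N; last by lia.
rewrite exprM sqr_sqrtr// mulrC /mode_growth -exprM exprMn mulnC !exprM.
by rewrite -[2 ^+ m ^+ 2]exprM mulnC exprM (_ : 2 ^+ 2 = 4)//; ring.
Qed.

(** A Hilbert norm dominates every single weighted coefficient; increasing the weight by
    the power [k] given by nuclearity then makes these bounds summable. *)
Lemma hida_l1_le : exists k : nat, forall m F, F \in @hida_pred R n ->
  l1_le m F (2 * Num.sqrt (fine (hnorm2 (4 * (m + k.+1))%:R (4 ^+ (m + k.+1)) F))).
Proof.
have [k Hk] := sum_growth_nuclear R n; exists k => m F /hidaP FH s us.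
set h := hnorm2 _ _ _.
have h_fin : (h < +oo)%E by apply: FH; rewrite ?exprn_gt0// ltr0n; lia.
have h_ge0 : (0 <= h)%E by apply: hnorm2_ge0; rewrite exprn_gt0.
have pt I : normc (F I) * growth R I ^+ (m + k.+1) <= Num.sqrt (fine h).
  rewrite -[leLHS]ger0_norm ?l1_term_ge0// -sqrtr_sqr ler_wsqrtr// -sqr_l1_term.
  rewrite -lee_fin fineK ?ge0_fin_numE//; apply: esum_ge.
  by exists [set I]%classic; rewrite ?fsbig_set1//; split.
apply: (@le_trans _ _ (\sum_(I <- s) Num.sqrt (fine h) * growth R I ^- k)).
  apply: ler_sum => I _; rewrite ler_pdivlMr ?growthX_gt0// -mulrA -exprD.
  by apply: le_trans (pt I); rewrite ler_wpM2l ?normc_ge0// growth_leX// leq_add2l leqnSn.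
by rewrite -mulr_sumr mulrC ler_wpM2r ?sqrtr_ge0// Hk.
Qed.

(** Conversely an [l^1] norm dominates the [l^2] norm of the same weight, and every Hilbert
    weight is below some power of [growth]. *)
Lemma l1_le_hnorm2 r c : 0 < c -> exists m, forall F K,
  l1_le m F K -> (hnorm2 r c F <= (K ^+ 2)%:E)%E.
Proof.
move=> c0; pose m := (Num.truncn r + Num.truncn c).+1; exists m => F K FK.
have rm : r <= m%:R.
  by rewrite (le_trans (ltW (truncnS_gt r)))// ler_nat /m ltnS leq_addr.
have cm : c <= 2 ^+ m.
  rewrite (le_trans (ltW (truncnS_gt c)))// -natrX ler_nat.
  by rewrite (leq_trans _ (ltnW (ltn_expl m _)))// /m ltnS leq_addl.
have wle I : weight r I * c ^+ size I <= growth R I ^+ m.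
  rewrite /weight /growth; elim: (I : seq _) => [|a s IHs] /=.
    by rewrite !big_nil expr1n mulr1.
  rewrite !big_cons exprS mulrACA exprMn.
  have s1 := symb_ge1 R a.1; have s0 : 0 <= symb R a.1 by rewrite (le_trans _ s1).
  have sq1 : 1 <= Num.sqrt (symb R a.1) by rewrite -sqrtr1 ler_wsqrtr.
  apply: ler_pM => //.
  - by rewrite mulr_ge0 ?powR_ge0// ltW.
  - by rewrite mulr_ge0 ?exprn_ge0 ?(ltW c0)// prodr_ge0// => b _; rewrite powR_ge0.
  rewrite /mode_growth exprMn mulrC ler_pM ?powR_ge0 ?(ltW c0)//.
  apply: (le_trans (ler_powR sq1 rm)); rewrite powR_mulrn ?sqrtr_ge0//.
  rewrite lerXn2r ?nnegrE ?sqrtr_ge0// -[leRHS]ger0_norm// -sqrtr_sqr ler_wsqrtr//.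
  by rewrite expr2 ler_peMr.
have K0 := l1_le_ge0 FK.
apply: ge_ereal_sup => _ [X [finX _] <-]; rewrite fsbig_finite//= sumEFin lee_fin.
apply: (@le_trans _ _ (\sum_(I <- fset_set X) (normc (F I) * growth R I ^+ m) * K)).
  apply: ler_sum => I _; rewrite /hterm -mulrA.
  apply: (@le_trans _ _ ((normc (F I) * growth R I ^+ m) ^+ 2)).
    rewrite exprMn ler_wpM2l ?sqr_ge0// (le_trans (wle I))// expr2 ler_peMr//.
      by rewrite ltW// growthX_gt0.
    by rewrite exprn_ege1// growth_ge1.
  by rewrite expr2 ler_wpM2l ?l1_term_ge0// l1_le_coef.
by rewrite -mulr_suml expr2 ler_wpM2r// FK// fset_uniq.
Qed.

Lemma hida_predP F : F \in @hida_pred R n <-> forall m, exists K, l1_le m F K.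
Proof.
split=> [FH m|FK].
  by have [k /(_ m F FH)] := hida_l1_le; exists (2 * Num.sqrt (fine (hnorm2
    (4 * (m + k.+1))%:R (4 ^+ (m + k.+1)) F))).
apply/hidaP => r c r0 c0; have [m Hm] := l1_le_hnorm2 r c0.
by have [K /Hm/le_lt_trans->//] := FK m; rewrite ltry.
Qed.

End Seminorms.

(** * Tame operators and density of finite sums *)

Section Tameness.
Variables (R : realType) (n : nat).
Local Open Scope mset_scope.
Local Open Scope complex_scope.
Notation H := (hida R n).
Implicit Types (F G : H) (I J : {mset mode n}) (m : nat) (T : H -> H).

Lemma hida_eqP F G : (F : fseries R n) =1 G <-> F = G.
Proof. by split=> [FG|->//]; apply/val_inj/funext. Qed.

Lemma hida_bounded F m : exists K, l1_le m F K.
Proof. by move/hida_predP: (hida_valP F); exact. Qed.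

(** The [l^1] seminorms and the Hilbert norms define the same topology, so that tameness
    can be proved with the former, for which all the operators below are explicit. *)
Lemma bounded_tame_estimate (B : H -> H -> H) :
  (forall m, exists m' C, 0 <= C /\ forall F G K L,
     l1_le m' F K -> l1_le m' G L -> l1_le m (B F G) (C * K * L)) ->
  tame_estimate B.
Proof.
move=> tB r c r0 c0; have [m Hm] := l1_le_hnorm2 n r c0.
have [m' [C [C0 HB]]] := tB m; have [k Hk] := hida_l1_le R n.
exists (4 * (m' + k.+1))%:R, (4 ^+ (m' + k.+1)), (4 * C); split.
- by rewrite ltr0n; lia.
- by rewrite exprn_gt0.
move=> F G; have := HB _ _ _ _ (Hk m' _ (hida_valP F)) (Hk m' _ (hida_valP G)).
rewrite /hnorm; set f := Num.sqrt _; set g := Num.sqrt _ => /[dup] BFG /Hm le.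
have K0 := l1_le_ge0 BFG; have -> : 4 * C * f * g = C * (2 * f) * (2 * g) by ring.
rewrite -[leRHS]ger0_norm// -sqrtr_sqr ler_wsqrtr// -lee_fin fineK//.
by rewrite ge0_fin_numE ?hnorm2_ge0// (le_lt_trans le)// ltry.
Qed.

Definition tame T := forall m, exists m' C,
  0 <= C /\ forall F K, l1_le m' F K -> l1_le m (T F) (C * K).

Definition tame_linear T := linear T /\ tame T.

Lemma tame_linear_comp T1 T2 :
  tame_linear T1 -> tame_linear T2 -> tame_linear (fun F => T1 (T2 F)).
Proof.
move=> [l1 t1] [l2 t2]; split=> [k F G|m]; first by rewrite l2 l1.
have [m1 [C1 [C10 H1]]] := t1 m; have [m2 [C2 [C20 H2]]] := t2 m1.
exists m2, (C1 * C2); split=> [|F K FK]; first exact: mulr_ge0.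
by rewrite -mulrA; apply/H1/H2.
Qed.

Lemma tame_linearD T1 T2 :
  tame_linear T1 -> tame_linear T2 -> tame_linear (fun F => T1 F + T2 F).
Proof.
move=> [l1 t1] [l2 t2]; split=> [k F G|m]; first by rewrite l1 l2 scalerDr addrACA.
have [m1 [C1 [C10 H1]]] := t1 m; have [m2 [C2 [C20 H2]]] := t2 m.
exists (maxn m1 m2), (C1 + C2); split=> [|F K FK]; first exact: addr_ge0.
rewrite mulrDl; apply: l1_leD; [apply: H1|apply: H2]; apply: l1_le_weight FK.
  exact: leq_maxl.
exact: leq_maxr.
Qed.

Lemma tame_linearZ (k : R[i]) T : tame_linear T -> tame_linear (fun F => k *: T F).
Proof.
move=> [l t]; split=> [k' F G|m].
  by rewrite l scalerDr !scalerA mulrC.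
have [m' [C [C0 H]]] := t m; exists m', (normc k * C).
split=> [|F K FK]; first by rewrite mulr_ge0 ?normc_ge0.
by rewrite -mulrA; apply/l1_leZ/H.
Qed.

Lemma tame_linear0 : tame_linear (fun=> 0).
Proof.
split=> [k F G|m]; first by rewrite scaler0 addr0.
by exists m, 0; split=> // F K _; rewrite mul0r; exact: l1_le0.
Qed.

Lemma tame_linear_sum (A : Type) (s : seq A) (T : A -> H -> H) :
  (forall a, tame_linear (T a)) -> tame_linear (fun F => \sum_(a <- s) T a F).
Proof.
move=> tT; elim: s => [|a s IHs].
  by under eq_fun do rewrite big_nil; exact: tame_linear0.
by under eq_fun do rewrite big_cons; exact: tame_linearD.
Qed.

Definition truncate (s : seq {mset mode n}) F : H := \sum_(I <- s) F I *: hbasis R I.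

Lemma coef_sum (A : Type) (s : seq A) (f : A -> H) J :
  (\sum_(a <- s) f a : H) J = \sum_(a <- s) f a J.
Proof. by elim: s => [|a s IHs]; rewrite ?big_nil// !big_cons -IHs. Qed.

Lemma truncateE s F J : uniq s -> truncate s F J = if J \in s then F J else 0.
Proof.
move=> us; rewrite coef_sum.
under eq_bigr do rewrite -[(_ *: _ : H) J]/(F _ * (J == _)%:R).
case: ifPn => [Js|Js].
  rewrite (bigD1_seq J)//= eqxx mulr1 big1 ?addr0// => I IJ.
  by rewrite eq_sym (negPf IJ) mulr0.
rewrite big1_seq// => I /= Is; case: eqVneq => [JI|]; rewrite ?mulr0//.
by rewrite JI Is in Js.
Qed.

Lemma truncate_approx F m (e : R) : 0 < e ->
  exists2 s, uniq s & l1_le m (F - truncate s F : H) e.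
Proof.
move=> e0; have [K FK] := hida_bounded F m.
have [S HS] := has_sum_nonneg (l1_term_ge0 m F) FK.
have [s0 Hs0] := HS _ (divr_gt0 e0 (ltr0n _ 2)).
exists (undup s0) => [|t ut]; first exact: undup_uniq.
set s := undup s0 in Hs0 *; have us : uniq s by exact: undup_uniq.
pose f I := normc (F I) * growth R I ^+ m.
have Hf t' : uniq t' -> {subset s <= t'} -> `|\sum_(I <- t') f I - S| <= e / 2.
  move=> ut' st'; rewrite -normc_real rmorphB rmorph_sum.
  by apply: Hs0 => // x x0; apply: st'; rewrite mem_undup.
pose t1 := [seq I <- t | I \notin s].
have -> : \sum_(I <- t) normc ((F - truncate s F : H) I) * growth R I ^+ m = \sum_(I <- t1) f I.
  rewrite big_filter [RHS]big_mkcond/=; apply: eq_bigr => I _.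
  rewrite [X in normc X](_ : _ = F I - truncate s F I)// truncateE//.
  by case: ifPn => Is; rewrite ?subr0//= subrr normc0 mul0r.
have ucat : uniq (s ++ t1).
  rewrite cat_uniq us filter_uniq// andbT/= -all_predC; apply/allP => I.
  by rewrite mem_filter => /andP[].
have h1 := Hf s us (fun _ => id).
have h2 : `|\sum_(I <- s ++ t1) f I - S| <= e / 2.
  by apply: Hf => // I Is; rewrite mem_cat Is.
move: h1 h2; rewrite big_cat/= !ler_distl; lra.
Qed.

(** The finite sums are dense: the difference of the two operators vanishes on every
    truncation of [F] and is small on the remainder. *)
Lemma tame_linear_eq T1 T2 : tame_linear T1 -> tame_linear T2 ->
  (forall I, T1 (hbasis R I) = T2 (hbasis R I)) -> T1 =1 T2.
Proof.
move=> t1 t2 T12 F.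
have [] : tame_linear (fun F => T1 F + (-1) *: T2 F).
  by apply: tame_linearD => //; exact: tame_linearZ.
set T := fun F => _ => lT tT.
suff : T F = 0 by rewrite /T scaleN1r => /eqP; rewrite subr_eq0 => /eqP.
 have [m [C [C0 HC]]] := tT 0%N.
have addT G H : T (G + H) = T G + T H by rewrite -[G in LHS]scale1r lT scale1r.
have T0 : T 0 = 0 by apply: (addrI (T 0)); rewrite -addT !addr0.
have Ttr s : T (truncate s F) = 0.
  rewrite /truncate; elim: s => [|I s IHs]; first by rewrite big_nil.
  by rewrite big_cons lT IHs addr0 /T T12 scaleN1r subrr scaler0.
apply/hida_eqP => I; apply/eq0_normc/eqP; rewrite eq_le normc_ge0 andbT.
apply/ler_addgt0Pr => e e0; rewrite add0r.
have Ce : 0 < e / (C + 1) by rewrite divr_gt0// ltr_wpDl.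
have [s us Fs] := truncate_approx F m Ce.
have := l1_le_coef I (HC _ _ Fs); rewrite expr0 mulr1.
have -> : T (F - truncate s F) = T F.
  by rewrite -[X in _ = T X](subrK (truncate s F) F) [RHS]addT Ttr addr0.
move=> /le_trans; apply; rewrite mulrCA ger_pMr// ler_pdivrMr ?mul1r ?lerDl//.
by rewrite ltr_wpDl.
Qed.

End Tameness.

(** * Extension by continuity from monomials *)

Section Extension.
Variables (R : realType) (n : nat).
Local Open Scope mset_scope.
Local Open Scope complex_scope.
Notation H := (hida R n).
Implicit Types (F G : H) (I J : {mset mode n}) (m : nat) (e : {mset mode n} -> H).

(** The growth condition on the values at the monomials under which a linear operator
    extends from finite sums to the whole space. *)
Definition controlled e := forall m, exists m' C,
  0 <= C /\ forall I, l1_le m (e I) (C * growth R I ^+ m').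

Definition extension_series e F : fseries R n := fun J => csum (fun I => F I * e I J).

Lemma extension_has_sum e F J : controlled e ->
  has_sum (fun I => F I * e I J) (extension_series e F J).
Proof.
move=> ce; have [m [C [C0 HC]]] := ce 0%N; have [K FK] := hida_bounded F m.
apply: (@csumP _ _ _ (C * K)) => s us.
apply: le_trans (ler_wpM2l C0 (FK s us)).
rewrite mulr_sumr; apply: ler_sum => I _; rewrite normcM mulrCA.
rewrite ler_wpM2l ?normc_ge0//.
by have := l1_le_coef J (HC I); rewrite expr0 mulr1.
Qed.

(** In [l^1] seminorms the norm of the operator is governed by its values at the monomials;
    all the coefficients in the finite set [s] are replaced by finite sums over one common
    set of monomials, with a total error [d]. *)
Lemma extension_series_l1_le e F m m' C K : controlled e -> 0 <= C ->
  (forall I, l1_le m (e I) (C * growth R I ^+ m')) -> l1_le m' F K ->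
  l1_le m (extension_series e F) (C * K).
Proof.
move=> ce C0 HC FK s us; apply/ler_addgt0Pr => d d0.
pose A := \sum_(J <- s) growth R J ^+ m.
have A0 : 0 <= A by rewrite sumr_ge0// => J _; rewrite ltW// growthX_gt0.
have d1 : 0 < d / (A + 1) by rewrite divr_gt0// ltr_wpDl.
have [t ut Ht] := has_sum_common s d1 (fun J => extension_has_sum F J ce).
apply: (@le_trans _ _ (\sum_(J <- s) (normc (\sum_(I <- t) F I * e I J) * growth R J ^+ m +
    d / (A + 1) * growth R J ^+ m))).
  rewrite big_seq [leRHS]big_seq; apply: ler_sum => J Js.
  rewrite -mulrDl ler_wpM2r ?(ltW (growthX_gt0 _ _ _))//.
  have := normc_subadd (extension_series e F J) (\sum_(I <- t) F I * e I J) 0.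
  rewrite !subr0 => /le_trans; apply; rewrite addrC lerD2l -normcN opprB; exact: Ht.
rewrite big_split/=; apply: lerD; last first.
  by rewrite -mulr_sumr -/A mulrAC -mulrA ger_pMr// ler_pdivrMr ?mul1r ?lerDl// ltr_wpDl.
apply: le_trans (ler_wpM2l C0 (FK t ut)); rewrite mulr_sumr.
apply: (@le_trans _ _ (\sum_(J <- s) \sum_(I <- t)
    normc (F I) * (normc (e I J) * growth R J ^+ m))).
  apply: ler_sum => J _; under [leRHS]eq_bigr do rewrite mulrA.
  rewrite -mulr_suml ler_wpM2r ?(ltW (growthX_gt0 _ _ _))//.
  by apply: (le_trans (normc_sum _ _)); apply: ler_sum => I _; rewrite normcM.
rewrite exchange_big/=; apply: ler_sum => I _.
by rewrite -mulr_sumr mulrCA ler_wpM2l ?normc_ge0// HC.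
Qed.

Lemma extension_hida e F : controlled e -> extension_series e F \in @hida_pred R n.
Proof.
move=> ce; apply/hida_predP => m; have [m' [C [C0 HC]]] := ce m.
have [K FK] := hida_bounded F m'; exists (C * K).
exact: extension_series_l1_le HC FK.
Qed.

Definition extension e (ce : controlled e) F : H := Hida (extension_hida F ce).

Lemma extension_l1_le e (ce : controlled e) F m m' C K : 0 <= C ->
  (forall I, l1_le m (e I) (C * growth R I ^+ m')) -> l1_le m' F K ->
  l1_le m (extension ce F) (C * K).
Proof. exact: extension_series_l1_le. Qed.

Lemma extension_tame_linear e (ce : controlled e) : tame_linear (extension ce).
Proof.
split=> [k F G|m].
  apply/hida_eqP => J; apply: csumE.
  have := has_sumD (has_sumZ k (extension_has_sum F J ce)) (extension_has_sum G J ce).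
  congr has_sum; apply/funext => I.
  by rewrite mulrA -mulrDl.
have [m' [C [C0 HC]]] := ce m; exists m', C; split=> // F K.
exact: extension_l1_le.
Qed.

Lemma extension_basis e (ce : controlled e) I : extension ce (hbasis R I) = e I.
Proof.
apply/hida_eqP => J; apply: csumE.
have := @has_sum_finite _ _ (fun I' => hbasis R I I' * e I' J) [:: I] isT.
rewrite big_seq1 /= /fbasis eqxx mul1r; apply=> I'.
by rewrite inE => /negPf->; rewrite mul0r.
Qed.

End Extension.

(** * Multiplication, derivatives and Wick product of formal series *)

Section FormalSeries.
Variables (R : realType) (n : nat).
Local Open Scope mset_scope.
Local Open Scope complex_scope.
Notation S := (fseries R n).
Implicit Types (F G : S) (I J : {mset mode n}) (a b : mode n).

Lemma mset_mode_case a J : a \notin J \/ exists J', J = a +` J'.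
Proof.
case: (boolP (a \in J)) => aJ; last by left.
by right; exists (J `\ a); rewrite msetB1K.
Qed.

(** The Wick product with the generator attached to the mode [a]. *)
Definition mulmode a F : S := fun J => if a \in J then F (J `\ a) else 0.

Lemma mulmode1D a F J : mulmode a F (a +` J) = F J.
Proof. by rewrite /mulmode in_mset1D eqxx/= msetD1K. Qed.

Lemma mulmode_notin a F J : a \notin J -> mulmode a F J = 0.
Proof. by rewrite /mulmode => /negPf->. Qed.

Lemma mulmode_linear a : linear (mulmode a).
Proof.
move=> k F G; apply/funext => J.
change ((mulmode a (k *: F + G)) J = k * mulmode a F J + mulmode a G J).
rewrite /mulmode; case: ifP => // _; by rewrite mulr0 addr0.
Qed.
HB.instance Definition _ a :=
  GRing.isLinear.Build R[i] S S *:%R (mulmode a) (mulmode_linear a).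

Lemma annih_linear a : linear (@annih R n a).
Proof.
move=> k F G; apply/funext => J.
change ((J a).+1%:R * (k * F (a +` J) + G (a +` J)) =
  k * ((J a).+1%:R * F (a +` J)) + (J a).+1%:R * G (a +` J) :> R[i]).
by ring.
Qed.
HB.instance Definition _ a :=
  GRing.isLinear.Build R[i] S S *:%R (@annih R n a) (annih_linear a).

Lemma mulmode_basis a I : mulmode a (fbasis R I) = fbasis R (a +` I).
Proof.
apply/funext => J; case: (mset_mode_case a J) => [aJ|[J' ->]].
  rewrite mulmode_notin// /fbasis; case: eqVneq => // JaI.
  by rewrite JaI mset1D1 in aJ.
rewrite mulmode1D /fbasis; congr (_%:R); congr nat_of_bool.
apply/eqP/eqP => [->//|]; exact: (can_inj (msetDKB _)).
Qed.

Lemma annih_basis0 a I : a \notin I -> annih a (fbasis R I) = 0.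
Proof. by move=> /mset_eq0P aI; rewrite annih_basis aI scale0r. Qed.

Lemma annihC a b F : annih a (annih b F) = annih b (annih a F).
Proof.
apply/funext => J; rewrite /annih msetDCA !mulrA; congr (_ * _).
rewrite !mset1DE (eq_sym a); case: eqVneq => [->//|_].
by rewrite mulrC.
Qed.

(** The canonical commutation relation: annihilation by [b] is the partial derivative in the
    variable [b] and [mulmode a] the multiplication by the variable [a]. *)
Lemma annih_mulmode a b F :
  annih b (mulmode a F) = (b == a)%:R *: F + mulmode a (annih b F).
Proof.
apply/funext => J.
change ((J b).+1%:R * mulmode a F (b +` J) =
  (b == a)%:R * F J + mulmode a (annih b F) J :> R[i]).
case: (mset_mode_case a J) => [aJ|[J' ->]]; last first.
  rewrite msetDCA !mulmode1D /annih mset1DE.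
  case: eqVneq => [->|_] /=; rewrite ?add1n ?add0n; last by ring.
  by rewrite -natr1; ring.
rewrite (mulmode_notin _ aJ) addr0; case: eqVneq => [->|ba].
  by rewrite mulmode1D (mset_eq0P aJ).
by rewrite mulmode_notin ?mulr0 ?mul0r// in_mset1D negb_or eq_sym ba.
Qed.

Lemma wickE F G I : wick F G I = \sum_(p <- fset_set (decomp I)) F p.1 * G p.2.
Proof. by rewrite /wick fsbig_finite//; exact: finite_decomp. Qed.

Lemma wick_linearl G : linear ((@wick R n)^~ G).
Proof.
move=> k F F'; apply/funext => I.
change (wick (k *: F + F') G I = k * wick F G I + wick F' G I).
rewrite !wickE mulr_sumr -big_split/=; apply: eq_bigr => p _.
by rewrite mulrA -mulrDl.
Qed.

Lemma wickC F G : wick F G = wick G F.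
Proof.
apply/funext => I; rewrite /wick.
rewrite (@reindex_fsbig _ _ _ _ _ (fun p => (p.2, p.1)) (decomp I) (decomp I)).
  by apply: eq_fsbigr => p _; rewrite mulrC.
split=> [[A B] /= <-|[A B] [C D] _ _ [-> ->]//|[A B] /= <-].
  by rewrite /decomp/= msetDC.
by exists (B, A); rewrite /decomp//= msetDC.
Qed.

Lemma wick1 G : wick (fbasis R mset0) G = G.
Proof.
apply/funext => I; rewrite /wick (fsbigE [:: (mset0, I)])//=.
- by rewrite big_mkcond big_seq1 ifT ?inE/= ?mset0D// /fbasis eqxx mul1r.
- by move=> p /=; rewrite inE => /eqP->; rewrite mset0D.
move=> [A B] /= AB; rewrite inE /fbasis; have [A0|_ _] := eqVneq A mset0; last by rewrite mul0r.
by move: AB; rewrite A0 mset0D => -> /eqP[].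
Qed.

(** The decompositions of [a +` I'] in which the first part contains [a] correspond to the
    decompositions of [I']. *)
Lemma wick_mulmode a F G : wick (mulmode a F) G = mulmode a (wick F G).
Proof.
apply/funext => I; case: (mset_mode_case a I) => [aI|[I' ->]].
  rewrite mulmode_notin// /wick; apply: fsbig1 => p /= pI.
  rewrite mulmode_notin ?mul0r//; apply: contra aI.
  by rewrite -pI in_msetD => ->.
pose h (p : {mset mode n} * {mset mode n}) := (a +` p.1, p.2).
rewrite mulmode1D /wick; transitivity (\sum_(p \in h @` decomp I') mulmode a F p.1 * G p.2).
  apply/esym/fsbig_widen => [_ [p /= <- <-]|[A B] [/= AB H]]; first by rewrite /= msetDA.
  case: (mset_mode_case a A) => [aA|[A' A'E]]; first by rewrite mulmode_notin ?mul0r.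
  case: H; exists (A', B); last by rewrite /h A'E.
  apply: (can_inj (msetDKB [mset a])); rewrite -AB A'E; exact: msetDA.
rewrite fsbig_image => [|[A B] [C D] _ _ [/(can_inj (msetDKB _)) -> ->]//].
by apply: eq_fsbigr => p _; rewrite mulmode1D.
Qed.

End FormalSeries.

(** * The recursion for the Moyal product *)

Section LinearPredicate.
Variables (K : pzRingType) (U V : lmodType K) (f : U -> V).
Hypothesis lf : linear f.

Let fL : {linear U -> V} := HB.pack f (GRing.isLinear.Build K U V *:%R f lf).

Lemma lin0 : f 0 = 0. Proof. exact: (raddf0 fL). Qed.
Lemma linD u v : f (u + v) = f u + f v. Proof. exact: (raddfD fL). Qed.
Lemma linN u : f (- u) = - f u. Proof. exact: (raddfN fL). Qed.
Lemma linZ k u : f (k *: u) = k *: f u. Proof. exact: (linearZ_LR fL). Qed.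
Lemma lin_sum (A : Type) (s : seq A) (P : pred A) (F : A -> U) :
  f (\sum_(i <- s | P i) F i) = \sum_(i <- s | P i) f (F i).
Proof. exact: (raddf_sum fL). Qed.
End LinearPredicate.

Lemma scaler_commute (K : comPzRingType) (U : lmodType K) (c d : K) (u : U) :
  c *: (d *: u) = d *: (c *: u).
Proof. by rewrite !scalerA mulrC. Qed.

Section StarFormula.
Variables (R : realType) (n : nat) (W : mode n -> mode n -> R).
Local Open Scope mset_scope.
Local Open Scope complex_scope.
Notation S := (fseries R n).
Implicit Types (F G : S) (I J : {mset mode n}) (a b : mode n) (s : seq (mode n)).

Definition same_freq a : seq (mode n) := [seq (a.1, j) | j <- enum 'I_n].

Hypothesis W_diag : forall a b, W a b != 0 -> b \in same_freq a.

(** The formula for the coefficient of [h^l], with the first derivatives restricted to the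
    finite list [s] and one contraction performed at a time; the weight [1 / l!] is spread
    over the steps. *)
Fixpoint contract s (l : nat) F G : S :=
  if l is l'.+1 then (l%:R)^-1 *: \sum_(a <- s) \sum_(b <- same_freq a)
    (W a b)%:C *: contract s l' (annih a F) (annih b G)
  else wick F G.
Arguments contract : simpl never.

Lemma contract0 s F G : contract s 0 F G = wick F G. Proof. by []. Qed.

Lemma contractS s l F G : contract s l.+1 F G = (l.+1%:R)^-1 *:
  \sum_(a <- s) \sum_(b <- same_freq a)
    (W a b)%:C *: contract s l (annih a F) (annih b G).
Proof. by []. Qed.

Lemma contract_linearl s l G : linear ((contract s l)^~ G).
Proof.
elim: l G => [|l IHl] G k F F'; first exact: wick_linearl.
rewrite !contractS.
rewrite scaler_commute -scalerDr; congr (_ *: _).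
rewrite scaler_sumr -big_split/=; apply: eq_bigr => a _.
rewrite scaler_sumr -big_split/=; apply: eq_bigr => b _.
by rewrite scaler_commute -scalerDr linearP IHl.
Qed.

Lemma contract_linearr s l F : linear (contract s l F).
Proof.
elim: l F => [|l IHl] F k G G'.
  by rewrite !contract0 !(wickC F); exact: wick_linearl.
rewrite !contractS.
rewrite scaler_commute -scalerDr; congr (_ *: _).
rewrite scaler_sumr -big_split/=; apply: eq_bigr => a _.
rewrite scaler_sumr -big_split/=; apply: eq_bigr => b _.
by rewrite scaler_commute -scalerDr linearP IHl.
Qed.

(** The recursion in the left factor on which everything rests.  Among the [l.+1]
    contractions either none or exactly one differentiates the new factor [x_a], and the
    [l.+1] choices of that contraction give equal terms, which cancels one factor of
    [1 / l.+1!]. *)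
Lemma contract_mulmode s l a F G : uniq s -> a \in s ->
  contract s l.+1 (mulmode a F) G = mulmode a (contract s l.+1 F G) +
    \sum_(b <- same_freq a) (W a b)%:C *: contract s l F (annih b G).
Proof.
move=> us as_.
have step l' F' G' : contract s l'.+1 (mulmode a F') G' =
    (l'.+1%:R)^-1 *: \sum_(b <- same_freq a) (W a b)%:C *: contract s l' F' (annih b G') +
    (l'.+1%:R)^-1 *: \sum_(c <- s) \sum_(b <- same_freq c)
      (W c b)%:C *: contract s l' (mulmode a (annih c F')) (annih b G').
  rewrite !contractS -scalerDr; congr (_ *: _).
  under eq_bigr => c _ do under eq_bigr => b _ do
    rewrite annih_mulmode contract_linearl scalerDr scalerA mulrC -scalerA.
  under eq_bigr => c _ do rewrite big_split/= -scaler_sumr.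
  rewrite big_split/=; congr (_ + _).
  rewrite (bigD1_seq a)//= eqxx scale1r [X in _ + X]big1 ?addr0// => c ca.
  by rewrite (negPf ca) scale0r.
elim: l F G => [|l IHl] F G; rewrite step addrC.
  rewrite contractS invr1 !scale1r; congr (_ + _).
  rewrite linear_sum/=; apply: eq_bigr => c _.
  by rewrite linear_sum/=; apply: eq_bigr => b _; rewrite linearZ/= !contract0 wick_mulmode.
under eq_bigr => c _ do under eq_bigr => b _ do rewrite IHl scalerDr.
under eq_bigr => c _ do rewrite big_split/=.
rewrite big_split/= scalerDr -addrA; congr (_ + _).
  rewrite [in RHS]contractS [RHS]linearZ/=; congr (_ *: _).
  rewrite linear_sum/=; apply: eq_bigr => c _.
  rewrite linear_sum/=; apply: eq_bigr => b _. exact/esym/(linZ (mulmode_linear a)).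
set X := \sum_(b <- same_freq a) _ *: contract _ l.+1 _ _.
suff -> : \sum_(c <- s) \sum_(b <- same_freq c) (W c b)%:C *:
    (\sum_(b' <- same_freq a) (W a b')%:C *:
      contract s l (annih c F) (annih b' (annih b G))) = l.+1%:R *: X.
  rewrite -scalerDr -[X in _ *: (_ + X)]scale1r -scalerDl natr1 scalerA.
  by rewrite mulVf ?scale1r ?pnatr_eq0.
rewrite /X scaler_sumr.
under [RHS]eq_bigr => b' _ do
  rewrite contractS scaler_commute [l.+1%:R *: _]scalerA mulfV ?pnatr_eq0// scale1r scaler_sumr.
rewrite [RHS]exchange_big/=; apply: eq_bigr => c _.
under eq_bigr => b _ do rewrite scaler_sumr.
under [RHS]eq_bigr => b _ do rewrite scaler_sumr.
rewrite exchange_big/=; apply: eq_bigr => b' _; apply: eq_bigr => b _.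
by rewrite annihC !scalerA mulrC.
Qed.

Definition star_term F G (w : seq (mode n * mode n)) : S :=
  (\prod_(q <- w) (W q.1 q.2)%:C) *:
    wick (foldr (@annih R n) F [seq q.1 | q <- w]) (foldr (@annih R n) G [seq q.2 | q <- w]).

Lemma foldr_annih_out a F t :
  foldr (@annih R n) (annih a F) t = annih a (foldr (@annih R n) F t).
Proof. by elim: t => //= b t ->; rewrite annihC. Qed.

Lemma foldr_annih0 F t a : a \in t -> annih a F = 0 -> foldr (@annih R n) F t = 0.
Proof.
elim: t => //= b t IHt; rewrite inE => /predU1P[<-|/IHt{}IHt] aF.
  by rewrite -foldr_annih_out aF; elim: t {IHt} => //= c t ->; rewrite linear0.
by rewrite IHt// linear0.
Qed.

(** Only derivatives along the modes of [F] contribute, so the sum over all tuples of pairs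
    of modes is a sum over the words in a finite alphabet [t]. *)
Lemma star_formula_contract s l F G : uniq s ->
  (forall a, a \notin s -> annih a F = 0) -> star_formula W l F G = contract s l F G.
Proof.
move=> us sF; pose t := [seq (a, b) | a <- s, b <- same_freq a].
have ut : uniq t.
  apply: allpairs_uniq_dep => //.
    by move=> a _; rewrite map_inj_uniq ?enum_uniq// => i j [].
  by move=> [a b] [c d] _ _ [-> ->].
have supp w : ~~ all (mem t) w -> star_term F G w = 0.
  rewrite -has_predC => /hasP[[a b] wab]; rewrite /= => tab.
  have [as_|as_] := boolP (a \in s); last first.
    rewrite /star_term (foldr_annih0 _ (sF _ as_)) ?linear0; last first.
      by apply/mapP; exists (a, b).
    by rewrite (lin0 (wick_linearl _)) scaler0.
  have Wab : W a b = 0.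
    apply/eqP; apply: contraNT tab => /W_diag bb.
    by apply/allpairsPdep; exists a, b.
  by rewrite /star_term (big_rem _ wab)/= Wab mul0r scale0r.
transitivity ((l`!%:R)^-1 *: \sum_(w <- words t l) star_term F G w).
  rewrite /star_formula; congr (_ *: _).
  transitivity (\sum_(w \in [set w : seq (mode n * mode n) | size w = l]) star_term F G w).
    apply/esym; apply: (@reindex_fsbig _ _ _ _ _ (@tval l _) setT); split.
    - by move=> p _ /=; rewrite size_tuple.
    - by move=> p q _ _; exact: val_inj.
    - by move=> w /= wl; exists (tcast wl (in_tuple w)) => //; rewrite val_tcast.
  rewrite (fsbigE (words t l)) ?uniq_words//.
  - rewrite big_seq_cond [RHS]big_seq; apply: eq_bigl => w.
    by rewrite mem_words; case: eqVneq => //= wl; rewrite andb_idr// inE.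
  - by move=> w /=; rewrite mem_words => /andP[/eqP].
  - move=> w /= wl; rewrite mem_words wl eqxx/=; exact: supp.
elim: l F G {sF supp} => [|l IHl] F G.
  by rewrite /= big_seq1 /star_term /= big_nil scale1r invr1 scale1r.
rewrite contractS big_allpairs_dep/= big_allpairs_dep/= factS natrM invfM -scalerA.
congr (_ *: _); rewrite scaler_sumr; apply: eq_bigr => a _.
rewrite scaler_sumr; apply: eq_bigr => b _.
rewrite -IHl scaler_commute; congr (_ *: _); rewrite scaler_sumr; apply: eq_bigr => w _.
by rewrite /star_term big_cons/= !foldr_annih_out scalerA.
Qed.

Lemma star_formula_const l G :
  star_formula W l (fbasis R mset0) G = if l == 0 then G else 0.
Proof.
rewrite (@star_formula_contract [::])// => [|a _]; last by apply: annih_basis0; rewrite in_mset0.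
case: l => [|l] /=; first by rewrite contract0 wick1.
by rewrite contractS big_nil scaler0.
Qed.

Lemma star_formula_mulmode l a I G :
  star_formula W l.+1 (fbasis R (a +` I)) G =
  mulmode a (star_formula W l.+1 (fbasis R I) G) +
    \sum_(b <- same_freq a) (W a b)%:C *: star_formula W l (fbasis R I) (annih b G).
Proof.
pose s := undup (a +` I); have as_ : a \in s by rewrite mem_undup mset1D1.
have Is b : b \notin s -> annih b (fbasis R I) = 0.
  by move=> bs; apply: annih_basis0; apply: contra bs => ?; rewrite mem_undup mset1Dr.
have aIs b : b \notin s -> annih b (fbasis R (a +` I)) = 0.
  by rewrite mem_undup; exact: annih_basis0.
rewrite !(@star_formula_contract s) ?undup_uniq// -mulmode_basis.
rewrite contract_mulmode ?undup_uniq//; congr (_ + _); apply: eq_bigr => b _.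
by rewrite (@star_formula_contract s) ?undup_uniq.
Qed.

Lemma star_formula0 I G : star_formula W 0 (fbasis R I) G = wick (fbasis R I) G.
Proof.
rewrite (@star_formula_contract (undup I)) ?undup_uniq// => a.
by rewrite mem_undup; exact: annih_basis0.
Qed.

End StarFormula.

(** * Multiplication and derivatives on the Hida space *)

Section ModeOperators.
Variables (R : realType) (n : nat).
Local Open Scope mset_scope.
Local Open Scope complex_scope.
Notation H := (hida R n).
Implicit Types (F G : fseries R n) (I J : {mset mode n}) (a b : mode n).

Lemma l1_le_mulmode m a F K :
  l1_le m F K -> l1_le m (mulmode a F) (mode_growth R a ^+ m * K).
Proof.
move=> FK s us.
pose s' : seq {mset mode n} := [seq J `\ a | J <- [seq J <- s | a \in (J : {mset mode n})]].
have us' : uniq s'.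
  rewrite map_inj_in_uniq ?filter_uniq// => I J.
  rewrite !mem_filter => /andP[aI _] /andP[aJ _] IJ.
  by rewrite -(msetB1K aI) IJ msetB1K.
apply: le_trans (ler_wpM2l _ (FK s' us')); last first.
  by rewrite exprn_ge0// ltW// mode_growth_gt0.
rewrite big_map big_filter mulr_sumr [leRHS]big_mkcond/= le_eqVlt; apply/orP; left.
apply/eqP/eq_bigr => J _; rewrite /mulmode; case: ifPn => aJ; last by rewrite normc0 mul0r.
by rewrite -{2}(msetB1K aJ) growth1D exprMn mulrCA.
Qed.

(** The multiplicity produced by a derivative is at most [growth], which costs one level of
    weight. *)
Lemma l1_le_annih m a F K : l1_le m.+1 F K -> l1_le m (annih a F) K.
Proof.
move=> FK s us.
pose s' : seq {mset mode n} := [seq a +` J | J <- s].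
have us' : uniq s' by rewrite map_inj_uniq//; exact: (can_inj (msetDKB _)).
apply: le_trans (FK s' us'); rewrite big_map; apply: ler_sum => J _.
rewrite /annih normcM -[_.+1%:R](rmorph_nat (real_complex R)) normc_real normr_nat.
rewrite -mulrA mulrCA ler_wpM2l ?normc_ge0// exprS.
have -> : (J a).+1 = (a +` J) a by rewrite mset1DE eqxx.
rewrite ler_pM ?multiplicity_le_growth//; first by rewrite ltW// growthX_gt0.
rewrite lerXn2r ?nnegrE ?(ltW (growth_gt0 _ _))// growth1D.
by rewrite ler_peMl ?(ltW (growth_gt0 _ _))// (le_trans _ (mode_growth_ge2 _ _))// ler1n.
Qed.

Lemma hida_mulmode a (F : H) : mulmode a F \in @hida_pred R n.
Proof.
apply/hida_predP => m; have [K FK] := hida_bounded F m.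
by exists (mode_growth R a ^+ m * K); exact: l1_le_mulmode.
Qed.

Lemma hida_annih a (F : H) : annih a F \in @hida_pred R n.
Proof.
apply/hida_predP => m; have [K FK] := hida_bounded F m.+1.
by exists K; exact: l1_le_annih.
Qed.

Definition hmulmode a (F : H) : H := Hida (hida_mulmode a F).
Definition hannih a (F : H) : H := Hida (hida_annih a F).

Lemma hmulmode_tame_linear a : tame_linear (hmulmode a).
Proof.
split=> [k F G|m]; first by apply/val_inj; exact: (mulmode_linear a).
exists m, (mode_growth R a ^+ m); split=> [|F K]; last exact: l1_le_mulmode.
by rewrite exprn_ge0// ltW// mode_growth_gt0.
Qed.

Lemma hannih_tame_linear a : tame_linear (hannih a).
Proof.
split=> [k F G|m]; first by apply/val_inj; exact: (annih_linear a).
by exists m.+1, 1; split=> // F K; rewrite mul1r; exact: l1_le_annih.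
Qed.

Lemma hmulmode_basis a I : hmulmode a (hbasis R I) = hbasis R (a +` I).
Proof. by apply/val_inj; exact: mulmode_basis. Qed.

Lemma hannih_one a : hannih a (hone R n) = 0.
Proof. by apply/val_inj/annih_basis0; rewrite in_mset0. Qed.

Lemma hannih_mulmode a b (F : H) :
  hannih b (hmulmode a F) = (b == a)%:R *: F + hmulmode a (hannih b F).
Proof. by apply/val_inj; exact: annih_mulmode. Qed.

(** Density turns induction on monomials into a principle for the whole space.  The
    parameter [x] collects what varies during the induction: the order in [h] and the other
    arguments, which get differentiated. *)
Lemma tame_linear_mode_ind (X : Type) (T1 T2 : X -> H -> H) :
  (forall x, tame_linear (T1 x)) -> (forall x, tame_linear (T2 x)) ->
  (forall x, T1 x (hone R n) = T2 x (hone R n)) ->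
  (forall a (F : H), (forall x, T1 x F = T2 x F) ->
     forall x, T1 x (hmulmode a F) = T2 x (hmulmode a F)) ->
  forall x (F : H), T1 x F = T2 x F.
Proof.
move=> t1 t2 T0 TS x F; apply: (tame_linear_eq (t1 x) (t2 x)) => I.
elim/mset_ind: I x => [|a I IHI] x; first exact: T0.
by rewrite -hmulmode_basis; exact: TS.
Qed.

End ModeOperators.

(** * Exchange of nested sums *)

Section CauchySums.
Variable V : nmodType.

Lemma sum_exchange_le l (f : nat -> nat -> V) :
  \sum_(i < l.+1) \sum_(a < i.+1) f i a =
  \sum_(a < l.+1) \sum_(i < (l - a).+1) f (i + a)%N a.
Proof.
under eq_bigr => i _ do rewrite (big_ord_widen l.+1) ?ltn_ord//.
rewrite (exchange_big_dep predT)//=; apply: eq_bigr => a _.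
rewrite -(big_mkord xpredT (fun i => f (i + a)%N a)) -subSn ?leq_ord//.
by rewrite -{1}[a : nat]add0n -(big_addn _ _ _ xpredT (f ^~ a)) add0n big_geq_mkord.
Qed.

Lemma sum_exchange_antidiag l (f : nat -> nat -> V) :
  \sum_(i < l.+1) \sum_(a < (l - i).+1) f i a =
  \sum_(a < l.+1) \sum_(i < (l - a).+1) f i a.
Proof.
have widen (g : nat -> nat -> V) : \sum_(i < l.+1) \sum_(a < (l - i).+1) g i a =
    \sum_(i < l.+1) \sum_(a < l.+1 | (a + i <= l)%N) g i a.
  apply: eq_bigr => i _; rewrite (big_ord_widen l.+1) ?ltnS ?leq_subr//.
  by apply: eq_bigl => a; rewrite ltnS leq_subRL ?leq_ord// addnC.
rewrite widen (exchange_big_dep predT)//= (widen (fun a i => f i a)).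
by apply: eq_bigr => a _; apply: eq_bigl => i; rewrite addnC.
Qed.

Lemma sum_exchange_triple l (f : nat -> nat -> nat -> V) :
  \sum_(i < l.+1) \sum_(a < i.+1) f a (i - a)%N (l - i)%N =
  \sum_(a < l.+1) \sum_(i < (l - a).+1) f a i (l - a - i)%N.
Proof.
rewrite (sum_exchange_le l (fun i a => f a (i - a)%N (l - i)%N)).
apply: eq_bigr => a _; apply: eq_bigr => i _.
by rewrite addnK addnC subnDA.
Qed.

End CauchySums.

(** * The Moyal product on the Hida space *)

Lemma hida_val_sum (R : realType) (n : nat) (A : Type) (s : seq A) (f : A -> hida R n) :
  (\sum_(a <- s) f a : hida R n) = \sum_(a <- s) (f a : fseries R n) :> fseries R n.
Proof. by elim: s => [|a s IHs]; rewrite ?big_nil// !big_cons -IHs. Qed.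

Section StarCoefficients.
Variables (R : realType) (n : nat) (W : mode n -> mode n -> R) (M : R).
Local Open Scope mset_scope.
Local Open Scope complex_scope.
Notation H := (hida R n).
Implicit Types (F G : H) (I J : {mset mode n}) (a b : mode n).

Hypothesis W_diag : forall a b, W a b != 0 -> b \in same_freq a.
Hypothesis W_anti : forall a b, W b a = - W a b.
Hypothesis M_ge0 : 0 <= M.
Hypothesis W_bound : forall a, \sum_(b <- same_freq a) `|W a b| <= M * mode_growth R a.

Let k := Num.truncn (1 + M).

Let k_bound : 1 + M <= 2 ^+ k.
Proof.
rewrite (le_trans (ltW (truncnS_gt _)))// -natrX ler_nat -/k.
exact: ltn_expl.
Qed.

(** By the recursion, each factor [x_a] of the monomial either survives, at the price
    [mode_growth a ^+ m.+1], or is contracted, at the price [M * mode_growth a].  Since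
    [1 + M <= 2 ^+ k], both together cost at most [mode_growth a ^+ (m.+1 + k)].  The other
    argument is differentiated [l] times, whatever the monomial. *)
Lemma star_formula_l1_le m l I (G : fseries R n) K : l1_le (m.+1 + l) G K ->
  l1_le m.+1 (star_formula W l (fbasis R I) G) (growth R I ^+ (m.+1 + k) * K).
Proof.
elim/mset_ind: I l G K => [|a I IHI] l G K GK.
  rewrite (star_formula_const W_diag) growth_mset0 expr1n mul1r; case: eqP => _.
    by apply: l1_le_weight GK; rewrite leq_addr.
  by apply: l1_le_trans (@l1_le0 R n _); exact: l1_le_ge0 GK.
have gI : 0 <= growth R I ^+ (m.+1 + k) * K.
  by rewrite mulr_ge0 ?(l1_le_ge0 GK)// ltW// growthX_gt0.
have g2 := mode_growth_ge2 R a; set g := mode_growth R a in g2 *.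
have g1 : 1 <= g by rewrite (le_trans _ g2)// ler1n.
have g0 : 0 <= g by rewrite (le_trans _ g1).
have ggk : (1 + M) * g ^+ m.+1 <= g ^+ (m.+1 + k).
  rewrite exprD mulrC ler_wpM2l ?exprn_ge0// (le_trans k_bound)//.
  by rewrite lerXn2r ?nnegrE.
case: l => [|l] in GK *.
  rewrite star_formula0// -mulmode_basis wick_mulmode -(star_formula0 W_diag).
  apply: l1_le_trans (l1_le_mulmode a (IHI _ _ _ GK)).
  rewrite growth1D [(_ * growth R I) ^+ _]exprMn -/g -mulrA ler_wpM2r// (le_trans _ ggk)//.
  by rewrite ler_peMl ?exprn_ge0// lerDl.
rewrite (star_formula_mulmode W_diag).
apply: l1_le_trans (l1_leD (l1_le_mulmode a (IHI _ _ _ GK)) (l1_le_sum (same_freq a) (fun b =>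
  l1_leZ (W a b)%:C (IHI l _ _ (l1_le_annih b (_ : l1_le (m.+1 + l).+1 G K)))))); last first.
  by rewrite -addnS.
under eq_bigr do rewrite normc_real.
rewrite -mulr_suml -mulrDl growth1D [(_ * growth R I) ^+ _]exprMn -/g -mulrA ler_wpM2r// (le_trans _ ggk)//.
rewrite mulrDl mul1r lerD2l (le_trans (W_bound a))// ler_wpM2l//.
by rewrite -/g exprS ler_peMr// exprn_ege1.
Qed.

Lemma star_formula_controlled l (G : H) :
  exists e : {mset mode n} -> H, controlled e /\
    forall I, e I = star_formula W l (fbasis R I) G :> fseries R n.
Proof.
have Hm m : exists K, l1_le (m.+1 + l) G K by exact: hida_bounded.
have GH I : star_formula W l (fbasis R I) G \in @hida_pred R n.
  apply/hida_predP => m; have [K GK] := Hm m.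
  by eexists; apply: l1_le_weight (star_formula_l1_le _ _); [exact: leqnSn|exact: GK].
exists (fun I => Hida (GH I)); split=> // m; have [K GK] := Hm m.
exists (m.+1 + k)%N, K; split=> [|I]; first exact: l1_le_ge0 GK.
by rewrite mulrC; apply: l1_le_weight (star_formula_l1_le _ GK).
Qed.

Definition monomial_star l (G : H) : {mset mode n} -> H :=
  projT1 (cid (star_formula_controlled l G)).

Lemma monomial_star_controlled l G : controlled (monomial_star l G).
Proof. by rewrite /monomial_star; case: cid => e []. Qed.

Lemma monomial_starE l G I :
  monomial_star l G I = star_formula W l (fbasis R I) G :> fseries R n.
Proof. by rewrite /monomial_star; case: cid => e []. Qed.

(** The [l]-th coefficient of the Moyal product: extended by continuity in [F] only, since
    on a monomial [F] the formula is a finite sum for every [G]. *)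
Definition moyal l F G : H := extension (monomial_star_controlled l G) F.

Lemma moyal_basis l I G :
  moyal l (hbasis R I) G = star_formula W l (fbasis R I) G :> fseries R n.
Proof. by rewrite -monomial_starE /moyal extension_basis. Qed.

Lemma moyal_l1_le m l F G K L :
  l1_le (m.+1 + k) F K -> l1_le (m.+1 + l) G L -> l1_le m.+1 (moyal l F G) (L * K).
Proof.
move=> FK GL; apply: extension_l1_le FK => [|I]; first exact: l1_le_ge0 GL.
by rewrite monomial_starE mulrC; exact: star_formula_l1_le.
Qed.

Lemma moyal_linl l G : tame_linear (moyal l ^~ G).
Proof. exact: extension_tame_linear. Qed.

Lemma moyal_linr l F : tame_linear (moyal l F).
Proof.
split=> [c G G'|m].
  apply: (@tame_linear_eq _ _ (moyal l ^~ (c *: G + G'))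
    (fun F => c *: moyal l F G + moyal l F G')) => [||I].
  - exact: moyal_linl.
  - apply: tame_linearD; last exact: moyal_linl.
    by apply: tame_linearZ; exact: moyal_linl.
  apply/val_inj; rewrite [LHS]moyal_basis.
  rewrite [RHS](_ : _ = c *: star_formula W l (fbasis R I) G +
      star_formula W l (fbasis R I) G'); last by rewrite -!moyal_basis.
  rewrite !(@star_formula_contract _ _ _ W_diag (undup I)) ?undup_uniq//.
  - exact: contract_linearr.
  - by move=> a; rewrite mem_undup; exact: annih_basis0.
  - by move=> a; rewrite mem_undup; exact: annih_basis0.
  - by move=> a; rewrite mem_undup; exact: annih_basis0.
have [K FK] := hida_bounded F (m.+1 + k).
exists (m.+1 + l)%N, K; split=> [|G L GL]; first exact: l1_le_ge0 FK.
by rewrite mulrC; apply: l1_le_weight (moyal_l1_le FK GL).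
Qed.

Lemma moyal_tame_estimate l : tame_estimate (moyal l).
Proof.
apply: bounded_tame_estimate => m; exists (m.+1 + k + l)%N, 1; split=> // F G K L FK GL.
rewrite mul1r mulrC; apply: (l1_le_weight (leqnSn m)); apply: moyal_l1_le.
  by apply: l1_le_weight FK; rewrite leq_addr.
by apply: l1_le_weight GL; rewrite leq_add2r leq_addr.
Qed.

Lemma moyal_one l G : moyal l (hone R n) G = if l == 0%N then G else 0.
Proof.
by apply/val_inj; rewrite [LHS]moyal_basis star_formula_const//; case: eqP.
Qed.

Lemma moyal0_mulmode a F G : moyal 0 (hmulmode a F) G = hmulmode a (moyal 0 F G).
Proof.
apply: (@tame_linear_eq _ _ (fun F => moyal 0 (hmulmode a F) G)
  (fun F => hmulmode a (moyal 0 F G))) => [||I].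
- apply: (@tame_linear_comp _ _ (moyal 0 ^~ G)); [exact: moyal_linl|exact: hmulmode_tame_linear].
- apply: (@tame_linear_comp _ _ (hmulmode a)); [exact: hmulmode_tame_linear|exact: moyal_linl].
apply/val_inj; rewrite hmulmode_basis [LHS]moyal_basis.
by rewrite -[RHS]/(mulmode a (moyal 0 (hbasis R I) G)) moyal_basis !star_formula0// -mulmode_basis wick_mulmode.
Qed.

Lemma moyal_mulmode l a F G : moyal l.+1 (hmulmode a F) G =
  hmulmode a (moyal l.+1 F G) + \sum_(b <- same_freq a) (W a b)%:C *: moyal l F (hannih b G).
Proof.
apply: (@tame_linear_eq _ _ (fun F => moyal l.+1 (hmulmode a F) G)
  (fun F => hmulmode a (moyal l.+1 F G) +
    \sum_(b <- same_freq a) (W a b)%:C *: moyal l F (hannih b G))) => [||I].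
- apply: (@tame_linear_comp _ _ (moyal l.+1 ^~ G)); [exact: moyal_linl|exact: hmulmode_tame_linear].
- apply: tame_linearD.
    by apply: (@tame_linear_comp _ _ (hmulmode a)); [exact: hmulmode_tame_linear|exact: moyal_linl].
  by apply: tame_linear_sum => b; apply: tame_linearZ; exact: moyal_linl.
apply/val_inj; rewrite hmulmode_basis [LHS]moyal_basis (star_formula_mulmode W_diag).
rewrite -[RHS]/(mulmode a (moyal l.+1 (hbasis R I) G) + (\sum_(b <- same_freq a)
  (W a b)%:C *: moyal l (hbasis R I) (hannih b G) : H) : fseries R n).
rewrite hida_val_sum moyal_basis; congr (_ + _); apply: eq_bigr => b _.
by rewrite -[RHS]/((W a b)%:C *: (moyal l (hbasis R I) (hannih b G) : fseries R n)) moyal_basis.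
Qed.

(** The structure constants [W] do not depend on the variables, so that partial derivatives
    are derivations of the star-product. *)
Lemma hannih_moyal b l F G :
  hannih b (moyal l F G) = moyal l (hannih b F) G + moyal l F (hannih b G).
Proof.
pose T1 (x : nat * H) F := hannih b (moyal x.1 F x.2).
pose T2 (x : nat * H) F := moyal x.1 (hannih b F) x.2 + moyal x.1 F (hannih b x.2).
apply: (@tame_linear_mode_ind _ _ _ T1 T2 _ _ _ _ (l, G)) => {l F G} [[l G]|[l G]|[l G]|a F IHF [l G]].
- apply: (@tame_linear_comp _ _ (hannih b)); [exact: hannih_tame_linear|exact: moyal_linl].
- apply: tame_linearD; last exact: moyal_linl.
  apply: (@tame_linear_comp _ _ (moyal l ^~ G)); [exact: moyal_linl|exact: hannih_tame_linear].
- rewrite /T1 /T2 /= hannih_one (lin0 (proj1 (moyal_linl _ _))) add0r !moyal_one.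
  by case: eqP => // _; rewrite (lin0 (proj1 (@hannih_tame_linear R n b))).
have {}IHF l' G' : hannih b (moyal l' F G') = moyal l' (hannih b F) G' + moyal l' F (hannih b G').
  exact: (IHF (l', G')).
have lM := proj1 (@hmulmode_tame_linear R n a); have lA := proj1 (@hannih_tame_linear R n b).
have lP l' G' := proj1 (moyal_linl l' G').
rewrite /T1 /T2 /= hannih_mulmode (linD (lP _ _)) (linZ (lP _ _)).
case: l => [|l].
  by rewrite !moyal0_mulmode hannih_mulmode IHF (linD lM) addrA.
rewrite !moyal_mulmode (linD lA) hannih_mulmode IHF (linD lM) (lin_sum lA).
rewrite -!addrA; congr (_ + (_ + _)); rewrite addrCA; congr (_ + _).
rewrite -big_split/=; apply: eq_bigr => c _.
rewrite (linZ lA) IHF scalerDr; congr (_ + _ *: moyal _ _ _).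
by apply/val_inj; exact: annihC.
Qed.

(** Each coefficient of [F G] involves finitely many monomials of [F]. *)
Lemma moyal0E F G : moyal 0 F G = hwick F G.
Proof.
apply/hida_eqP => J; apply: csumE.
have -> : (fun I => F I * monomial_star 0 G I J) = (fun I =>
    \sum_(p <- fset_set (decomp J)) F I * ((p.1 == I)%:R * G p.2)).
  apply/funext => I; rewrite (congr1 (fun f : fseries R n => f J) (monomial_starE _ _ _)).
  by rewrite star_formula0// wickE mulr_sumr.
rewrite /= wickE; apply: has_sum_sum => p.
have := @has_sum_finite _ _ (fun I => F I * ((p.1 == I)%:R * G p.2)) [:: p.1] isT.
rewrite big_seq1 eqxx mul1r; apply=> I; rewrite inE eq_sym => /negPf->.
by rewrite mul0r mulr0.
Qed.

Lemma moyal0C F G : moyal 0 F G = moyal 0 G F.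
Proof. by rewrite !moyal0E; apply/val_inj; exact: wickC. Qed.

Lemma moyal_oner l F : moyal l.+1 F (hone R n) = 0.
Proof.
pose T1 l F := moyal l.+1 F (hone R n); pose T2 (l : nat) (F : H) : H := 0.
apply: (@tame_linear_mode_ind _ _ _ T1 T2) => {l F} [l|l|l|a F IHF l].
- exact: moyal_linl.
- exact: tame_linear0.
- exact: moyal_one.
rewrite /T1 /T2 moyal_mulmode big1 ?addr0 => [|b _].
  by rewrite [moyal _ _ _]IHF (lin0 (proj1 (@hmulmode_tame_linear R n a))).
by rewrite hannih_one (lin0 (proj1 (moyal_linr _ _))) scaler0.
Qed.

Lemma star_formula1 (F G : fseries R n) : star_formula W 1 F G = poisson_formula W F G.
Proof.
rewrite /star_formula /poisson_formula invr1 scale1r.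
rewrite (@reindex_fsbigT _ _ _ _ _ (fun q => [tuple q])); last first.
  exists (fun t => tnth t ord0) => [q|t]; first by rewrite tnth0.
  by apply/val_inj; case/tupleP: t => q t; rewrite tnth0 /= tuple0.
by apply: eq_fsbigr => q _; rewrite /= big_seq1.
Qed.

Lemma poisson_formulaC (F G : fseries R n) : poisson_formula W F G = - poisson_formula W G F.
Proof.
rewrite /poisson_formula (@reindex_fsbigT _ _ _ _ _ (fun q => (q.2, q.1))); last first.
  by exists (fun q => (q.2, q.1)) => -[].
transitivity (\sum_(q \in setT) - ((W q.1 q.2)%:C *: wick (annih q.1 G) (annih q.2 F))).
  by apply: eq_fsbigr => q _ /=; rewrite wickC W_anti rmorphN scaleNr.
rewrite -sumrN; congr (\big[_/_]_(q <- _) _).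
rewrite /finite_support !unlock; congr (fset_set (_ `&` _)).
apply/seteqP; split=> q /= Hq E; apply: Hq; first by rewrite E oppr0.
by rewrite -[LHS]opprK E oppr0.
Qed.

Lemma moyal1_anti F G : moyal 1 F G = - moyal 1 G F.
Proof.
rewrite -scaleN1r.
have basis I : moyal 1 (hbasis R I) G = (-1) *: moyal 1 G (hbasis R I).
  apply: (@tame_linear_eq _ _ (moyal 1 (hbasis R I)) (fun G => (-1) *: moyal 1 G (hbasis R I))).
  - exact: moyal_linr.
  - by apply: tame_linearZ; exact: moyal_linl.
  move=> J; rewrite scaleN1r; apply/val_inj; rewrite [LHS]moyal_basis.
  rewrite -[RHS]/(- (moyal 1 (hbasis R J) (hbasis R I) : fseries R n)) moyal_basis.
  by rewrite !star_formula1; exact: poisson_formulaC.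
apply: (@tame_linear_eq _ _ (moyal 1 ^~ G) (fun F => (-1) *: moyal 1 G F)) => //.
- exact: moyal_linl.
- by apply: tame_linearZ; exact: moyal_linr.
Qed.

(** Both sides satisfy the same recursion in [F].  Multiplying [F] by [x_a] multiplies both
    of them by [x_a] and adds, on the left, the contraction of [x_a] with the product of [G]
    and [K], which the Leibniz rule [hannih_moyal] splits into the contractions with [G] and
    with [K]; on the right, the contraction with [G] arises in the inner product and the one
    with [K] in the outer product. *)
Lemma moyal_assoc N F G K :
  \sum_(j < N.+1) moyal (N - j) F (moyal j G K) =
  \sum_(j < N.+1) moyal (N - j) (moyal j F G) K.
Proof.
pose T1 (x : nat * H * H) F := \sum_(j < x.1.1.+1) moyal (x.1.1 - j) F (moyal j x.1.2 x.2).
pose T2 (x : nat * H * H) F := \sum_(j < x.1.1.+1) moyal (x.1.1 - j) (moyal j F x.1.2) x.2.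
apply: (@tame_linear_mode_ind _ _ _ T1 T2 _ _ _ _ (N, G, K)) => {N F G K}
  [[[N G] K]|[[N G] K]|[[N G] K]|a F IHF [[N G] K]].
- by apply: tame_linear_sum => j; exact: moyal_linl.
- apply: tame_linear_sum => j.
  by apply: (@tame_linear_comp _ _ (moyal _ ^~ K)); exact: moyal_linl.
- rewrite /T1 /T2 /= big_ord_recr big_ord_recl/= subnn subn0 !moyal_one/=.
  rewrite big1 ?add0r => [|j _]; last by rewrite moyal_one subn_eq0 leqNgt ltn_ord.
  by rewrite big1 ?addr0// => j _; rewrite moyal_one (lin0 (proj1 (moyal_linl _ _))).
have {}IHF N' G' K' : \sum_(j < N'.+1) moyal (N' - j) F (moyal j G' K') =
    \sum_(j < N'.+1) moyal (N' - j) (moyal j F G') K' by exact: (IHF (N', G', K')).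
have lM := proj1 (@hmulmode_tame_linear R n a).
have lP l G' := proj1 (moyal_linl l G'); have lQ l F' := proj1 (moyal_linr l F').
rewrite /T1 /T2 /=; case: N => [|N].
  rewrite !big_ord1 !moyal0_mulmode; congr hmulmode.
  by have := IHF 0%N G K; rewrite !big_ord1.
transitivity (hmulmode a (\sum_(j < N.+2) moyal (N.+1 - j) F (moyal j G K)) +
    \sum_(b <- same_freq a) (W a b)%:C *: \sum_(j < N.+1)
      (moyal (N - j) F (moyal j (hannih b G) K) + moyal (N - j) F (moyal j G (hannih b K)))).
  rewrite big_ord_recr/= subnn moyal0_mulmode.
  rewrite [X in _ = hmulmode a X + _]big_ord_recr/= subnn (linD lM) [RHS]addrAC.
  congr (_ + _); rewrite (lin_sum lM).
  under [in X in _ = _ + X]eq_bigr => b _ do rewrite scaler_sumr.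
  rewrite exchange_big/= -big_split/=; apply: eq_bigr => j _.
  rewrite subSn ?leq_ord// moyal_mulmode; congr (_ + _); apply: eq_bigr => b _.
  by rewrite hannih_moyal (linD (lQ _ _)).
transitivity (hmulmode a (\sum_(j < N.+2) moyal (N.+1 - j) (moyal j F G) K) +
    \sum_(b <- same_freq a) (W a b)%:C *: \sum_(j < N.+1)
      (moyal (N - j) (moyal j F (hannih b G)) K + moyal (N - j) (moyal j F G) (hannih b K))).
  rewrite (IHF N.+1 G K); congr (_ + _); apply: eq_bigr => b _; congr (_ *: _).
  by rewrite !big_split/= (IHF N (hannih b G) K) (IHF N G (hannih b K)).
pose rest j := if j is j'.+1 then
  \sum_(b <- same_freq a) (W a b)%:C *: moyal j' F (hannih b G) else 0.
have inner j : moyal j (hmulmode a F) G = hmulmode a (moyal j F G) + rest j.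
  by case: j => [|j]; rewrite ?moyal0_mulmode ?addr0// moyal_mulmode.
under [RHS]eq_bigr => j _ do rewrite inner (linD (lP _ _)).
rewrite [RHS]big_split/=.
rewrite [X in _ = X + _]big_ord_recr/= subnn moyal0_mulmode.
rewrite [X in _ = _ + X]big_ord_recl/= (lin0 (lP _ _)) add0r.
rewrite (lin_sum lM) big_ord_recr/= subnn.
under [X in _ = X + _ + _]eq_bigr => j _ do rewrite subSn ?leq_ord// moyal_mulmode.
rewrite big_split/= -!addrA; congr (_ + _).
  by apply: eq_bigr => j _; rewrite subSn ?leq_ord.
rewrite addrCA; congr (_ + _).
under eq_bigr => b _ do rewrite scaler_sumr.
rewrite exchange_big/= addrC -big_split/=; apply: eq_bigr => j _.
rewrite add0n subSS (lin_sum (lP _ _)) -big_split/=; apply: eq_bigr => b _.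
by rewrite scalerDr (linZ (lP _ _)).
Qed.

(** At order one the recursion contracts [x_a] with [K] only, and does so in the same way
    whether [x_a] stands in [F] or in the product of [F] and [G]. *)
Lemma hwick_moyal1 F G K :
  moyal 1 (hwick F G) K = hwick F (moyal 1 G K) + hwick (moyal 1 F K) G.
Proof.
rewrite -!moyal0E.
pose T1 (x : H * H) F := moyal 1 (moyal 0 F x.1) x.2.
pose T2 (x : H * H) F := moyal 0 F (moyal 1 x.1 x.2) + moyal 0 (moyal 1 F x.2) x.1.
apply: (@tame_linear_mode_ind _ _ _ T1 T2 _ _ _ _ (G, K)) => {F G K}
  [[G K]|[G K]|[G K]|a F IHF [G K]].
- by apply: (@tame_linear_comp _ _ (moyal 1 ^~ K)); exact: moyal_linl.
- apply: tame_linearD; first exact: moyal_linl.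
  by apply: (@tame_linear_comp _ _ (moyal 0 ^~ G)); exact: moyal_linl.
- by rewrite /T1 /T2 /= !moyal_one (lin0 (proj1 (moyal_linl _ _))) addr0.
have lM := proj1 (@hmulmode_tame_linear R n a).
have lP l G' := proj1 (moyal_linl l G').
rewrite /T1 /T2 /= !moyal0_mulmode !moyal_mulmode (linD (lP _ _)) moyal0_mulmode.
have := IHF (G, K); rewrite /T1 /T2 /= => ->; rewrite (linD lM) -!addrA; congr (_ + (_ + _)).
rewrite (lin_sum (lP _ _)); apply: eq_bigr => b _; rewrite (linZ (lP _ _)); congr (_ *: _).
have := moyal_assoc 0 F (hannih b K) G; rewrite !big_ord1 => <-.
by have := moyal_assoc 0 F G (hannih b K); rewrite !big_ord1 => <-; rewrite (moyal0C G).
Qed.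

Lemma coefD F G I : (F + G : H) I = F I + G I. Proof. by []. Qed.
Lemma coefN F I : (- F : H) I = - F I. Proof. by []. Qed.

(** The Jacobi identity is the antisymmetrization of associativity at order [h^2]: the terms
    with one coefficient of order [2] and one of order [0] cancel because the Wick product
    is commutative. *)
Lemma moyal1_jacobi F G K :
  moyal 1 F (moyal 1 G K) + moyal 1 G (moyal 1 K F) + moyal 1 K (moyal 1 F G) = 0.
Proof.
have rearrange (x1 x2 x3 y1 y2 y3 : R[i]) :
    x1 + x2 + x3 = y1 - y2 + y3 -> x2 + y2 = y3 - x3 + (y1 - x1).
  move=> E; have -> : x2 = y1 - y2 + y3 - x1 - x3 by rewrite -E; ring.
  by ring.
have assoc2 A B C I : moyal 1 A (moyal 1 B C) I + moyal 1 C (moyal 1 A B) I =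
    moyal 0 C (moyal 2 A B) I - moyal 0 A (moyal 2 B C) I +
    (moyal 2 (moyal 0 A B) C I - moyal 2 A (moyal 0 B C) I).
  have := moyal_assoc 2 A B C; rewrite !big_ord_recr !big_ord0/= !add0r !subn0.
  rewrite (_ : 2 - 1 = 1)%N// (_ : 2 - 2 = 0)%N// (moyal0C (moyal 2 A B)).
  rewrite (moyal1_anti (moyal 1 A B) C) => E.
  have := congr1 (fun X : H => hida_val X I) E; cbv beta; rewrite !coefD coefN => {}E.
  exact: rearrange E.
have swap A B C : moyal 1 A (moyal 1 C B) = - moyal 1 A (moyal 1 B C).
  by rewrite (moyal1_anti C) (linN (proj1 (moyal_linr _ _))).
apply/hida_eqP => I; rewrite !coefD.
have combine (a b c p q r p' q' r' u v w u' v' w' : R[i]) :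
    a + c = r - p + (u - v') -> b + a = p - q + (v - w') -> c + b = q - r + (w - u') ->
    - a - b = q' - p' + (w - v') -> - c - a = p' - r' + (v - u') -> - b - c = r' - q' + (u - w') ->
    a + b + c = 0.
  move=> e1 e2 e3 f1 f2 f3.
  have -> : a + b + c = 4^-1 * ((a + c) + (b + a) + (c + b) -
      (- a - b) - (- c - a) - (- b - c)) by field.
  by rewrite e1 e2 e3 f1 f2 f3; ring.
have := assoc2 F K G I; have := assoc2 K G F I; have := assoc2 G F K I.
rewrite (swap F G K) (swap G K F) (swap K F G) !coefN.
rewrite (moyal0C F K) (moyal0C K G) (moyal0C G F) => f3 f2 f1.
exact: combine (assoc2 F G K I) (assoc2 G K F I) (assoc2 K F G I) f1 f2 f3.
Qed.

(** A finite sum is one of its truncations, on which the product is computed by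
    bilinearity from the monomials. *)
Lemma moyal_finite_sum l F G : finite_sum (F : fseries R n) ->
  moyal l F G = star_formula W l F G :> fseries R n.
Proof.
move=> finF; pose s := enum_fset (fset_set [set I | F I != 0]%classic).
have us : uniq s by exact: fset_uniq.
have sF (I : {mset mode n}) : I \notin s -> F I = 0.
  by move=> Is; apply/eqP; apply: contraNT Is => FI; rewrite in_fset_set// inE.
pose t := undup (flatten (map (@enum_mset (mode n)) s)).
have ts a (I : {mset mode n}) : a \notin t -> I \in s -> a \notin I.
  rewrite mem_undup => at_ Is; apply: contra at_ => aI.
  by apply/flattenP; exists (enum_mset I) => //; exact: map_f.
have tF a : a \notin t -> annih a F = 0.
  move=> at_; apply/funext => J; rewrite /annih sF ?mulr0//.
  by apply/negP => /(ts a _ at_); rewrite mset1D1.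
have FE : F = truncate s F.
  by apply/hida_eqP => I; rewrite truncateE//; case: ifPn => // /sF.
rewrite (@star_formula_contract R n W W_diag t l F G (undup_uniq _) tF) {1}FE /truncate.
rewrite (lin_sum (proj1 (moyal_linl _ _))) hida_val_sum [in RHS]FE /truncate hida_val_sum.
rewrite (lin_sum (contract_linearl W t l G)) !big_seq; apply: eq_bigr => I Is.
rewrite (linZ (proj1 (moyal_linl _ _))).
rewrite -[LHS]/(F I *: (moyal l (hbasis R I) G : fseries R n)) moyal_basis.
rewrite (@star_formula_contract R n W W_diag t l _ G (undup_uniq _)) => [|a /ts aI]; last exact/annih_basis0/aI.
by rewrite -(linZ (contract_linearl W t l G)).
Qed.

(** The [C[[h]]]-bilinear extension of the coefficients [moyal]. *)
Definition moyal_star (u v : nat -> H) : nat -> H := fun l =>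
  \sum_(i < l.+1) \sum_(j < (l - i).+1) moyal (l - i - j) (u i) (v j).

Lemma moyal_star_constl F v l :
  moyal_star (hconst F) v l = \sum_(j < l.+1) moyal (l - j) F (v j).
Proof.
rewrite /moyal_star big_ord_recl/= subn0 [X in _ + X]big1 ?addr0// => i _.
by apply: big1 => j _; rewrite /= (lin0 (proj1 (moyal_linl _ _))).
Qed.

Lemma moyal_star_constr u G l :
  moyal_star u (hconst G) l = \sum_(i < l.+1) moyal (l - i) (u i) G.
Proof.
apply: eq_bigr => i _; rewrite big_ord_recl/= subn0 big1 ?addr0// => j _.
by rewrite /= (lin0 (proj1 (moyal_linr _ _))).
Qed.

Lemma moyal_star_coef l F G : star_coef moyal_star l F G = moyal l F G.
Proof.
rewrite /star_coef moyal_star_constl big_ord_recl/= subn0 big1 ?addr0// => j _.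
by rewrite (lin0 (proj1 (moyal_linr _ _))).
Qed.

Lemma moyal_poisson : poisson_structure (moyal 1).
Proof.
have derl F G K : moyal 1 (hwick F G) K = hwick F (moyal 1 G K) + hwick (moyal 1 F K) G.
  exact: hwick_moyal1.
have wickN F G : hwick F (- G) = - hwick F G.
  by rewrite -!moyal0E (linN (proj1 (moyal_linr _ _))).
have hwickC F G : hwick F G = hwick G F by rewrite -!moyal0E moyal0C.
split=> //.
- by move=> G; case: (moyal_linl 1 G).
- by move=> F; case: (moyal_linr 1 F).
- exact: moyal1_anti.
- exact: moyal1_jacobi.
- move=> F G K; rewrite moyal1_anti derl opprD (hwickC (moyal 1 G F)) -!wickN.
  by rewrite -!moyal1_anti addrC (hwickC K).
- by move=> F; rewrite moyal_one.
- exact: moyal_tame_estimate.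
Qed.

Lemma moyal_star_product : star_product (moyal 1) moyal_star.
Proof.
have lP l G := proj1 (moyal_linl l G); have lQ l F := proj1 (moyal_linr l F).
split.
- move=> u v w; apply/funext => l.
  rewrite -[RHS]/(moyal_star u w l + moyal_star v w l) -big_split; apply: eq_bigr => i _.
  by rewrite -big_split; apply: eq_bigr => j _; exact: (linD (lP _ _)).
- move=> u v w; apply/funext => l.
  rewrite -[RHS]/(moyal_star u v l + moyal_star u w l) -big_split; apply: eq_bigr => i _.
  by rewrite -big_split; apply: eq_bigr => j _; exact: (linD (lQ _ _)).
- move=> c u v; apply/funext => l.
  rewrite /hscale /moyal_star.
  pose f (q i r : nat) := \sum_(j < r.+1) c q *: moyal (r - j) (u i) (v j).
  transitivity (\sum_(i < l.+1) \sum_(a < i.+1) f a (i - a)%N (l - i)%N).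
    apply: eq_bigr => i _; rewrite exchange_big/=; apply: eq_bigr => j _.
    by rewrite (lin_sum (lP _ _)); apply: eq_bigr => a _; rewrite (linZ (lP _ _)).
  rewrite sum_exchange_triple; apply: eq_bigr => a _; rewrite scaler_sumr.
  by apply: eq_bigr => i _; rewrite scaler_sumr.
- move=> c u v; apply/funext => l.
  rewrite /hscale /moyal_star.
  pose g (i q : nat) := \sum_(j < (l - i - q).+1) c q *: moyal (l - i - q - j) (u i) (v j).
  transitivity (\sum_(i < l.+1) \sum_(a < (l - i).+1) g i a).
    apply: eq_bigr => i _.
    rewrite -(sum_exchange_triple _ (fun q j r : nat => c q *: moyal r (u i) (v j))).
    apply: eq_bigr => j _; rewrite (lin_sum (lQ _ _)).
    by apply: eq_bigr => a _; rewrite (linZ (lQ _ _)).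
  rewrite sum_exchange_antidiag; apply: eq_bigr => a _; rewrite scaler_sumr.
  apply: eq_bigr => i _; rewrite scaler_sumr /g subnAC.
  by apply: eq_bigr => j _.
- by move=> F G; rewrite moyal_star_coef moyal0E.
- by move=> F G; rewrite !moyal_star_coef (moyal1_anti G) opprK scaler_nat.
- move=> l r c r0 c0; have [r1 [c1 [K [r10 c10 HK]]]] := moyal_tame_estimate l r0 c0.
  by exists r1, c1, K; split=> // F G; rewrite moyal_star_coef.
- move=> [//|l] c F _.
  by rewrite moyal_star_coef (linZ (lP _ _)) moyal_one scaler0.
- move=> [//|l] c F _.
  by rewrite moyal_star_coef (linZ (lQ _ _)) moyal_oner scaler0.
- move=> F G K; apply/funext => l; rewrite moyal_star_constl moyal_star_constr.
  have coef A B j : moyal_star (hconst A) (hconst B) j = moyal j A B.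
    exact: moyal_star_coef.
  under eq_bigr do rewrite coef.
  under [RHS]eq_bigr do rewrite coef.
  exact: moyal_assoc.
Qed.

Lemma moyal_theorem : exists (br : H -> H -> H) (star : (nat -> H) -> (nat -> H) -> (nat -> H)),
  [/\ poisson_structure br,
      forall F G : H, finite_sum (F : fseries R n) -> finite_sum (G : fseries R n) ->
        br F G = poisson_formula W F G :> fseries R n,
      star_product br star &
      forall (l : nat) (F G : H), finite_sum (F : fseries R n) -> finite_sum (G : fseries R n) ->
        star_coef star l F G = star_formula W l F G :> fseries R n].
Proof.
exists (moyal 1), moyal_star; split.
- exact: moyal_poisson.
- by move=> F G finF _; rewrite moyal_finite_sum// star_formula1.
- exact: moyal_star_product.
- by move=> l F G finF _; rewrite moyal_star_coef; exact: moyal_finite_sum.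
Qed.

End StarCoefficients.

(** * Orthogonality of the Fourier basis *)

Section Trigonometry.
Variable R : realType.
Implicit Types (k m p q : int) (s x : R).

Let freq m : R := 2 * pi * m%:~R.

Let freq_neq0 m : m != 0 -> freq m != 0.
Proof.
by move=> m0; rewrite !mulf_neq0 ?intr_eq0// gt_eqF// ?pi_gt0// ltr0n.
Qed.

Lemma integral01_derive (f F : R -> R) :
  (forall x, is_derive x 1 F (f x)) -> continuous f ->
  \int[lebesgue_measure]_(s in `[0, 1]%classic) f s = F 1 - F 0.
Proof.
move=> dF cf; rewrite /Rintegral (@continuous_FTC2 _ f F)//.
- exact: continuous_subspaceT.
- have cF x : {for x, continuous F}.
    by apply/differentiable_continuous/derivable1_diffP; case: (dF x).
  split.
  + by move=> x _; case: (dF x).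
  + exact/cvg_at_right_filter/cF.
  + exact/cvg_at_left_filter/cF.
- by move=> x _; rewrite derive1E; exact: derive_val.
Qed.

Lemma cos_freq m : cos (freq m) = 1.
Proof.
have H (j : nat) : cos (2 * pi * j%:R) = 1 :> R.
  have -> : 2 * pi * j%:R = 0 + pi *+ 2 *+ j :> R by rewrite add0r [LHS]mulr_natr mulr_natl.
  by rewrite (periodicn (@cosD2pi R)) cos0.
by rewrite /freq; case: m => j; rewrite ?NegzE ?rmorphN/= ?mulrN ?cosN H.
Qed.

Lemma sin_freq m : sin (freq m) = 0.
Proof.
by apply/eqP; rewrite -sqrf_eq0 -[_ ^+ 2](addKr (cos (freq m) ^+ 2)) cos2Dsin2 cos_freq expr1n addNr.
Qed.

Let wave m s : R := cos (freq m * s).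
Let wave' m s : R := sin (freq m * s).

(* Antiderivatives of the waves; a zero frequency has to be treated apart. *)
Let prim m s : R := if m == 0 then s else (freq m)^-1 * sin (freq m * s).
Let prim' m s : R := if m == 0 then 0 else - (freq m)^-1 * cos (freq m * s).

Let is_derive_lin (w x : R) : is_derive x 1 (fun s => w * s) w.
Proof.
have := @is_deriveZ _ _ _ (@id R) w x 1 1 (is_derive_id _ _).
by rewrite /GRing.scale/= mulr1.
Qed.

Let is_derive_prim m x : is_derive x 1 (prim m) (wave m x).
Proof.
rewrite /prim /wave; have [->|m0] := eqVneq m 0.
  by rewrite /freq mulr0 mul0r cos0; exact: is_derive_id.
have h := @is_derive1_comp R sin _ x _ _ (is_derive_sin _) (is_derive_lin (freq m) x).
have := @is_deriveZ _ _ _ _ (freq m)^-1 x 1 _ h.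
by rewrite /GRing.scale/= mulrCA mulVf ?mulr1 ?freq_neq0.
Qed.

Let is_derive_prim' m x : is_derive x 1 (prim' m) (wave' m x).
Proof.
rewrite /prim' /wave'; have [->|m0] := eqVneq m 0.
  by rewrite /freq mulr0 mul0r sin0; exact: is_derive_cst.
have h := @is_derive1_comp R cos _ x _ _ (is_derive_cos _) (is_derive_lin (freq m) x).
have := @is_deriveZ _ _ _ _ (- (freq m)^-1) x 1 _ h.
by rewrite /GRing.scale/= mulNr mulrCA mulVf ?mulr1 ?opprK ?freq_neq0.
Qed.

Let continuous_lin (w : R) : continuous (fun s : R => w * s).
Proof. by move=> x; apply: cvgM; [exact: cvg_cst|exact: cvg_id]. Qed.

Let continuous_wave m : continuous (wave m).
Proof.
by move=> x; apply: (@continuous_comp _ _ _ _ cos); [exact: continuous_lin|exact: continuous_cos].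
Qed.

Let continuous_wave' m : continuous (wave' m).
Proof.
by move=> x; apply: (@continuous_comp _ _ _ _ sin); [exact: continuous_lin|exact: continuous_sin].
Qed.

Lemma integral01_trig (u v w z : R) p q :
  \int[lebesgue_measure]_(s in `[0, 1]%classic)
    (u * cos (freq p * s) + v * cos (freq q * s) +
     (w * sin (freq p * s) + z * sin (freq q * s))) =
  u * (p == 0)%:R + v * (q == 0)%:R.
Proof.
pose G s := u * prim p s + v * prim q s + (w * prim' p s + z * prim' q s).
transitivity (G 1 - G 0); last first.
- have e m : prim m 1 - prim m 0 = (m == 0)%:R.
    rewrite /prim; case: eqP => _; first by rewrite subr0.
    by rewrite mulr1 sin_freq !mulr0 sin0 mulr0 subr0.
  have e' m : prim' m 1 = prim' m 0.
    by rewrite /prim'; case: eqP => // _; rewrite mulr1 cos_freq mulr0 cos0.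
  by rewrite /G !e' -!e; ring.
apply: integral01_derive.
- move=> x.
  have d := is_deriveD (is_deriveD (is_deriveZ u (is_derive_prim p x)) (is_deriveZ v (is_derive_prim q x)))
   (is_deriveD (is_deriveZ w (is_derive_prim' p x)) (is_deriveZ z (is_derive_prim' q x))).
  exact: d.
- by move=> x; do ![apply: cvgD | apply: cvgM; first exact: cvg_cst];
    do ?[exact: continuous_wave | exact: continuous_wave'].
Qed.

(** The scalar factor of [fourier]. *)
Definition harmonic k s : R :=
  if k == 0 then 1 else Num.sqrt 2 / Num.sqrt (symb R k) *
    (if 0 < k then cos (2 * pi * k%:~R * s) else sin (2 * pi * k%:~R * s)).

(** A product of two harmonics is a combination of waves of frequencies [k - m] and [k + m].
    Only a zero frequency contributes to the integral, and [k + m = 0] between harmonics of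
    the same kind forces [k = m = 0]. *)
Lemma harmonic_orthogonal x k m :
  \int[lebesgue_measure]_(s in `[0, 1]%classic) (x * (harmonic k s * harmonic m s)) =
  x * ((k == m)%:R / symb R k).
Proof.
pose c m : R := if m == 0 then 1 else Num.sqrt 2 / Num.sqrt (symb R m).
have hc k' s : harmonic k' s = c k' * (if 0 <= k' then cos (freq k' * s) else sin (freq k' * s)).
  rewrite /harmonic /c; have [->|k0] := eqVneq k' 0.
    by rewrite lexx /freq mulr0 mul0r cos0 mulr1.
  by rewrite le0r (negPf k0).
have fD s : freq (k + m) * s = freq k * s + freq m * s.
  by rewrite /freq rmorphD mulrDr mulrDl.
have fB s : freq (k - m) * s = freq k * s - freq m * s.
  by rewrite /freq rmorphB mulrBr mulrBl.
have c2 : c k * c k = if k == 0 then 1 else 2 / symb R k.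
  rewrite /c; case: eqP => _; first by rewrite mulr1.
  by rewrite -expr2 expr_div_n !sqr_sqrtr// (le_trans _ (symb_ge1 R k)).
have int u v w z : (forall s, x * (harmonic k s * harmonic m s) =
      u * cos (freq (k - m) * s) + v * cos (freq (k + m) * s) +
      (w * sin (freq (k - m) * s) + z * sin (freq (k + m) * s))) ->
    \int[lebesgue_measure]_(s in `[0, 1]%classic) (x * (harmonic k s * harmonic m s)) =
    u * (k == m)%:R + v * (k + m == 0)%:R.
  move=> E; rewrite -[k == m]subr_eq0 -(integral01_trig u v w z); congr Rintegral.
  exact/funext/E.
have symb0 : symb R 0 = 1 by rewrite /symb expr0n/= mulr0 add0r.
pose y := x * (c k * c m) / 2.
case: (lerP 0 k) => k0; case: (lerP 0 m) => m0.
- rewrite (int y y 0 0) => [|s]; last first.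
    by rewrite !hc k0 m0 fD fB cosB cosD /y; field.
  have [km|km] := eqVneq k m; last first.
    by rewrite (_ : k + m == 0 = false) ?mulr0n; [ring|lia].
  rewrite /y -km c2 (_ : k + k == 0 = (k == 0)); last by lia.
  case: eqVneq => [->|_] /=; first by rewrite symb0 invr1; field.
  by field; rewrite gt_eqF// (lt_le_trans _ (symb_ge1 R k)).
- rewrite (int 0 0 (- y) y) => [|s]; last first.
    by rewrite !hc k0 leNgt m0/= fD fB sinB sinD /y; field.
  by rewrite (_ : k == m = false) ?mulr0n; [ring|lia].
- rewrite (int 0 0 y y) => [|s]; last first.
    by rewrite !hc m0 leNgt k0/= fD fB sinB sinD /y; field.
  by rewrite (_ : k == m = false) ?mulr0n; [ring|lia].
- rewrite (int y (- y) 0 0) => [|s]; last first.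
    by rewrite !hc !leNgt k0 m0/= fD fB cosB cosD /y; field.
  rewrite (_ : k + m == 0 = false) ?mulr0n; last by lia.
  have [km|km] := eqVneq k m; last by rewrite mulr0n; ring.
  rewrite /y -km c2 (lt_eqF k0).
  by field; rewrite gt_eqF// (lt_le_trans _ (symb_ge1 R k)).
Qed.

End Trigonometry.

(** * The matrix of the symplectic form and its inverse *)

Section OmegaMatrix.
Variables (R : realType) (n : nat) (om : {skew_symmetric 'rV[R]_n}).
Implicit Types (a b c : mode n).

Lemma Omega_matrixE a b : Omega_matrix om a b =
  om 'e_(a.2) 'e_(b.2) * ((a.1 == b.1)%:R / symb R a.1).
Proof.
have fE (c : mode n) (s : R) : fourier c s = harmonic c.1 s *: 'e_(c.2).
  by rewrite /fourier /harmonic; case: eqP => // _; rewrite scale1r.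
rewrite /Omega_matrix /Omega -harmonic_orthogonal; congr Rintegral.
apply/funext => s; rewrite !fE linearZl_LR linearZr_LR /=; ring.
Qed.

Definition form_matrix : 'M[R]_n := \matrix_(i, j) om 'e_i 'e_j.

Lemma form_skew u v : om u v = - om v u.
Proof. by rewrite hermC expr1 mulN1r. Qed.

(** A vector in the kernel of the matrix lies in the radical of the form. *)
Lemma form_matrix_unit : nondegenerate om -> form_matrix \in unitmx.
Proof.
move=> /eqP nd; rewrite -row_free_unit -kermx_eq0; apply/rowV0P => v /sub_kermxP vM.
have v0 j : om v 'e_j = 0.
  have := congr1 (fun A : 'rV_n => A 0 j) vM; rewrite !mxE => <-.
  rewrite [in LHS](row_sum_delta v) linear_sumlz; apply: eq_bigr => i _.
  by rewrite linearZl_LR mxE.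
apply/eqP; rewrite -memv0 -nd; apply/mem_orthovP => w _.
by rewrite (row_sum_delta w) linear_sumr big1// => i _; rewrite linearZr_LR /= v0 mulr0.
Qed.

End OmegaMatrix.

Section OmegaInverse.
Variables (R : realType) (n : nat) (om : {skew_symmetric 'rV[R]_n}).
Hypothesis om_nondegenerate : nondegenerate om.
Local Open Scope classical_set_scope.
Implicit Types (a b c : mode n).

Let N := invmx (form_matrix om).

Definition Omega_inverse a b : R := (a.1 == b.1)%:R * symb R a.1 * N a.2 b.2.

Lemma mem_same_freq a b : (b \in same_freq a) = (b.1 == a.1).
Proof.
apply/mapP/eqP => [[j _ ->]//|ba]; exists b.2; rewrite ?mem_enum// -ba.
by case: b {ba}.
Qed.

Lemma sum_same_freq (f : mode n -> R) a : (forall b, b \notin same_freq a -> f b = 0) ->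
  \sum_(b \in [set: mode n]) f b = \sum_(j < n) f (a.1, j).
Proof.
move=> f0; rewrite (fsbigE (same_freq a)) => [|||b _]//; last exact: f0.
  by rewrite big_mkcond/= /same_freq big_map big_enum/=; under eq_bigr do rewrite in_setT.
by rewrite map_inj_uniq ?enum_uniq// => i j [].
Qed.

Let symb_neq0 k : symb R k != 0.
Proof. by rewrite gt_eqF// (lt_le_trans _ (symb_ge1 R k)). Qed.

Lemma Omega_matrix_freq a b : b \notin same_freq a -> Omega_matrix om a b = 0.
Proof. by rewrite mem_same_freq Omega_matrixE eq_sym => /negPf->; rewrite mul0r mulr0. Qed.

Lemma Omega_inverse_freq a b : b \notin same_freq a -> Omega_inverse a b = 0.
Proof. by rewrite mem_same_freq /Omega_inverse eq_sym => /negPf->; rewrite !mul0r. Qed.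

Lemma Omega_inverseP : inverse_matrix (Omega_matrix om) Omega_inverse.
Proof.
have Mu := form_matrix_unit om_nondegenerate.
have mode_eq a c : (a == c)%:R = (a.1 == c.1)%:R * (a.2 == c.2)%:R :> R.
  by case: a c => [k i] [k' i'] /=; rewrite xpair_eqE -natrM mulnb.
move=> a c; rewrite !(sum_same_freq (a := a)); last 2 first.
- by move=> b /Omega_inverse_freq->; rewrite mul0r.
- by move=> b /Omega_matrix_freq->; rewrite mul0r.
rewrite mode_eq; have [ac|ac] := eqVneq a.1 c.1; last first.
  split; rewrite big1 ?mul0r// => j _.
    by rewrite /Omega_inverse (negPf ac) !mul0r mulr0.
  by rewrite Omega_matrixE (negPf ac) mul0r !mulr0.
split.
  have := congr1 (fun A : 'M[R]_n => A a.2 c.2) (mulmxV Mu); rewrite !mxE mul1r => <-.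
  apply: eq_bigr => j _; rewrite Omega_matrixE /Omega_inverse /= ac !eqxx mxE /=.
  by field; exact: symb_neq0.
have := congr1 (fun A : 'M[R]_n => A a.2 c.2) (mulVmx Mu); rewrite !mxE mul1r => <-.
apply: eq_bigr => j _; rewrite Omega_matrixE /Omega_inverse /= ac !eqxx [form_matrix _ _ _]mxE /=.
by field; exact: symb_neq0.
Qed.

(** Both matrices are block diagonal with finite blocks, so the usual associativity
    argument applies. *)
Lemma Omega_inverse_unique B : inverse_matrix (Omega_matrix om) B ->
  forall a c, B a c = Omega_inverse a c.
Proof.
move=> HB a c.
transitivity (\sum_(j < n) \sum_(i < n) Omega_inverse a (a.1, i) *
    Omega_matrix om (a.1, i) (a.1, j) * B (a.1, j) c).
  have E j : \sum_(i < n) Omega_inverse a (a.1, i) * Omega_matrix om (a.1, i) (a.1, j) =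
      (a == (a.1, j))%:R.
    rewrite -(proj2 (Omega_inverseP a (a.1, j))) (sum_same_freq (a := a))//.
    by move=> d /Omega_inverse_freq->; rewrite mul0r.
  under [RHS]eq_bigr => j _ do rewrite -mulr_suml E.
  rewrite (bigD1 a.2)//= -surjective_pairing eqxx mul1r big1 ?addr0// => j ja.
  by rewrite [X in (X == _)%:R](surjective_pairing a) xpair_eqE [a.2 == _]eq_sym (negPf ja) andbF mul0r.
rewrite exchange_big/=.
transitivity (\sum_(i < n) Omega_inverse a (a.1, i) * ((a.1, i) == c)%:R).
  apply: eq_bigr => i _; rewrite -(proj1 (HB (a.1, i) c)) (sum_same_freq (a := (a.1, i))).
    by rewrite mulr_sumr; apply: eq_bigr => j _; rewrite mulrA.
  by move=> b /Omega_matrix_freq->; rewrite mul0r.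
rewrite -(sum_same_freq (f := fun d => Omega_inverse a d * (d == c)%:R)); last first.
  by move=> d /Omega_inverse_freq->; rewrite mul0r.
rewrite (fsbigE [:: c])//=; first by rewrite big_mkcond big_seq1 in_setT eqxx mulr1.
by move=> d _; rewrite inE => /negPf->; rewrite mulr0.
Qed.

Lemma Omega_inverse_anti a b : Omega_inverse b a = - Omega_inverse a b.
Proof.
rewrite /Omega_inverse eq_sym; case: eqP => [->|_]; last by rewrite !mul0r oppr0.
have NT : N^T = - N.
  have -> : N^T = invmx (- form_matrix om).
    by rewrite /N trmx_inv; congr invmx; apply/matrixP => i j; rewrite !mxE form_skew.
  rewrite -scaleN1r invmxZ ?invrN1 ?scaleN1r//.
  by rewrite -scaleN1r unitmxZ ?unitrN1// form_matrix_unit.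
by have := congr1 (fun A : 'M[R]_n => A a.2 b.2) NT; rewrite !mxE => ->; rewrite mulrN.
Qed.

Lemma Omega_inverse_bound a : \sum_(b <- same_freq a) `|Omega_inverse a b| <=
  (\sum_(i < n) \sum_(j < n) `|N i j|) * mode_growth R a.
Proof.
have symb_ge0 : 0 <= symb R a.1 by rewrite (le_trans _ (symb_ge1 R _)).
rewrite big_map big_enum/= [X in _ <= X * _](bigD1 a.2)//= mulrDl.
apply: ler_wpDr.
  rewrite mulr_ge0 ?(ltW (mode_growth_gt0 _ _))// sumr_ge0// => i _.
  by rewrite sumr_ge0.
rewrite mulr_suml ler_sum// => j _; rewrite /Omega_inverse eqxx mul1r normrM mulrC.
by rewrite ler_wpM2l// ger0_norm// /mode_growth ler_peMl// ler1n.
Qed.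

End OmegaInverse.

(** * The star-product *)

Theorem theorem2 (R : realType) (n : nat) (om : {skew_symmetric 'rV[R]_n})
    (om_nondegenerate : nondegenerate om) :
  (exists Oinv : mode n -> mode n -> R,
     inverse_matrix (Omega_matrix om) Oinv) /\
  forall Oinv : mode n -> mode n -> R,
    inverse_matrix (Omega_matrix om) Oinv ->
  exists (br : hida R n -> hida R n -> hida R n)
         (star : (nat -> hida R n) -> (nat -> hida R n) -> (nat -> hida R n)),
    [/\ poisson_structure br,
        forall F G : hida R n, finite_sum F -> finite_sum G ->
          br F G = poisson_formula Oinv F G :> fseries R n,
        star_product br star &
        forall (l : nat) (F G : hida R n), finite_sum F -> finite_sum G ->
          star_coef star l F G = star_formula Oinv l F G :> fseries R n].
Proof.
split; first by exists (Omega_inverse om); exact: Omega_inverseP.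
move=> Oinv /(Omega_inverse_unique om_nondegenerate) OE.
have -> : Oinv = Omega_inverse om by apply/funext => a; apply/funext => b.
apply: moyal_theorem (Omega_inverse_bound om) => [a b|a b|].
- by apply: contra_neqT => /Omega_inverse_freq->.
- exact: Omega_inverse_anti.
- by rewrite sumr_ge0// => i _; rewrite sumr_ge0.
Qed.
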